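(* Let $n,k\in\mathbb N$, $n\ge2$, let $\Omega\subseteq\mathbb R^n$ be open, and let $$\mathrm H\in C^1\Big(\Omega\times\mathbb R\times\mathbb R^n\times\mathbb R^{n^{\otimes2}}_{\mathrm s}\times\cdots\times\mathbb R^{n^{\otimes k}}_{\mathrm s}\Big).$$ Consider the supremal functional (scalar case $N=1$) $\mathrm E_\infty(u,\mathcal O)=\operatorname{ess\,sup}_{\mathcal O}\mathrm H(\cdot,D^{\vec k}u)$. Let $u\in C^{k+1}(\Omega)$ and suppose that the total semi-differential of $\mathrm E_\infty$ at $u$ is non-negative on compactly supported variations: $$(\mathfrak D\mathrm E_\infty)^+_u(\phi)\ge0\qquad\forall\,\phi\in W^{k,\infty}_c(\Omega).$$ Then $u$ is a solution to the $(k+1)$-th order fully nonlinear PDE $$\mathrm H_{,\mathbf X_k}(\cdot,D^{\vec k}u):\Big(D\big(\mathrm H(\cdot,D^{\vec k}u)\big)\Big)^{\otimes k}=0\quad\text{in }\Omega.$$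
   Context: $\mathbb R^{n^{\otimes j}}_{\mathrm s}$ is the space of symmetric $j$-tensors on $\mathbb R^n$; $D^{\vec k}u:=(u,Du,\dots,D^ku)$; the arguments of $\mathrm H$ are $(x,\mathbf X_0,\mathbf X_1,\dots,\mathbf X_k)$ with $\mathbf X_j\in\mathbb R^{n^{\otimes j}}_{\mathrm s}$ corresponding to $D^ju$; $\mathrm H_{,\mathbf X}$ is the derivative in $\mathbf X=(\mathbf X_0,\dots,\mathbf X_k)$ and $\mathrm H_{,\mathbf X_k}$ that in $\mathbf X_k$; ''$:$'' is the Euclidean inner product of tensors; $a^{\otimes k}$ is the $k$-fold tensor power of $a\in\mathbb R^n$. $W^{k,\infty}_c(\Omega)$ is the space of functions in $W^{k,\infty}(\Omega)$ with compact support in $\Omega$. Total semi-differential: $(\mathfrak D\mathrm E_\infty)^+_u(0):=0$, and for $\phi\ne0$ in $W^{k,\infty}_c(\Omega)$ (so that the open set $\{\phi\ne0\}$ is compactly contained in $\Omega$) $$(\mathfrak D\mathrm E_\infty)^+_u(\phi):=\lim_{t\to0^+}\frac{\mathrm E_\infty(u+t\phi,\{\phi\ne0\})-\mathrm E_\infty(u,\{\phi\ne0\})}{t},$$ which exists and equals $$\lim_{\varepsilon\to0^+}\ \operatorname*{ess\,sup}_{\{\mathrm H(\cdot,D^{\vec k}u)\ge\mathrm E_\infty(u,\{\phi\ne0\})-\varepsilon\}\cap\{\phi\ne0\}}\Big[\mathrm H_{,\mathbf X}(\cdot,D^{\vec k}u):D^{\vec k}\phi\Big].$$ *)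

(* Defs.v *)
From HB Require Import structures.
From mathcomp Require Import all_boot all_order all_algebra.
From mathcomp Require Import all_classical all_reals all_analysis.
From mathcomp Require Import ess_sup_inf.

Set Implicit Arguments.
Unset Strict Implicit.
Unset Printing Implicit Defensive.
Import Order.TTheory GRing.Theory Num.Theory.
Import numFieldNormedType.Exports.
Local Open Scope classical_set_scope.
Local Open Scope ring_scope.

(* R^n is 'rV[R]_n.  [rV_lebesgue n] is n-dimensional
   Lebesgue measure on the Borel (= product) sigma-algebra, built by
   R^(1+n) = R * R^n from the library's [lebesgue_measure] on R. *)

Definition rV_coord (T : Type) n (i : 'I_n) (x : 'rV[T]_n) : T := x ord0 i.

Definition rV_display : measure_display -> measure_display.
Proof. exact. Qed.

Section rV_measurable.
Context {R : realType} (n : nat).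
Let coords : 'I_n -> 'rV[R]_n -> R := @rV_coord R n.

Let mset0 : g_sigma_preimage coords set0.
Proof. exact: sigma_algebra0. Qed.

Let msetC A : g_sigma_preimage coords A -> g_sigma_preimage coords (~` A).
Proof. exact: sigma_algebraC. Qed.

Let mbigcup (F : (set 'rV[R]_n)^nat) :
  (forall i, g_sigma_preimage coords (F i)) ->
  g_sigma_preimage coords (\bigcup_i F i).
Proof. exact: sigma_algebra_bigcup. Qed.

HB.instance Definition _ :=
  @isMeasurable.Build (rV_display default_measure_display) 'rV[R]_n
    (g_sigma_preimage coords) mset0 msetC mbigcup.
End rV_measurable.

Section rV_measurable_fun.
Context {R : realType}.

Lemma measurable_rV_coord n (i : 'I_n) :
  measurable_fun [set: 'rV[R]_n] (rV_coord i).
Proof.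
move=> _ Y mY; rewrite setTI; apply: sub_sigma_algebra => /=.
rewrite -bigcup_seq/=; exists i => /=; first by rewrite mem_index_enum.
by exists Y => //; rewrite setTI.
Qed.

Lemma measurable_fun_rVP d (T : measurableType d) n (f : T -> 'rV[R]_n) :
  (forall i, measurable_fun setT (rV_coord i \o f)) -> measurable_fun setT f.
Proof.
move=> mf _ A mA.
suff : g_sigma_preimage (fun i => @rV_coord R n i \o f) `<=` measurable.
  by rewrite g_sigma_preimage_comp; apply; exists A.
apply: smallest_sub; first exact: sigma_algebra_measurable.
case: n => [|n] in f mf A mA *; first by rewrite big_ord0.
rewrite -bigcup_mkord_ord; apply: bigcup_sub => i Ii.
by move=> B [C mC <-]; exact: mf.
Qed.

Definition rV_cons n (p : R * 'rV[R]_n) : 'rV[R]_n.+1 :=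
  \row_i if unlift ord0 i is Some j then p.2 ord0 j else p.1.

Definition rV_uncons n (x : 'rV[R]_n.+1) : R * 'rV[R]_n :=
  (x ord0 ord0, \row_j x ord0 (lift ord0 j)).

Lemma rV_consK n : cancel (@rV_cons n) (@rV_uncons n).
Proof.
move=> [a x]; rewrite /rV_uncons; congr pair; first by rewrite mxE unlift_none.
by apply/rowP => j; rewrite !mxE liftK.
Qed.

Lemma measurable_rV_cons n : measurable_fun setT (@rV_cons n).
Proof.
apply: measurable_fun_rVP => i.
case: (unliftP ord0 i) => [j|] ->.
  rewrite (_ : _ \o _ = rV_coord j \o snd); last first.
    by apply/funext => p /=; rewrite /rV_coord mxE liftK.
  by apply: measurableT_comp => //; exact: measurable_rV_coord.
rewrite (_ : _ \o _ = fst)//.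
by apply/funext => p /=; rewrite /rV_coord mxE unlift_none.
Qed.

Lemma measurable_rV_uncons n : measurable_fun setT (@rV_uncons n).
Proof.
apply: measurable_fun_pair; first exact: measurable_rV_coord.
apply: measurable_fun_rVP => i.
rewrite (_ : _ \o _ = rV_coord (lift ord0 i)); first exact: measurable_rV_coord.
by apply/funext => x /=; rewrite /rV_coord mxE.
Qed.

End rV_measurable_fun.

Section rV_lebesgue_step.
Context {R : realType} (n : nat).
Variable m : {sigma_finite_measure set 'rV[R]_n -> \bar R}.
Local Open Scope ereal_scope.

Definition rV_product : set 'rV[R]_n.+1 -> \bar R :=
  pushforward (@lebesgue_measure R \x m) (@rV_cons R n).

Let mu0 : rV_product set0 = 0.
Proof. by rewrite /rV_product /pushforward preimage_set0 measure0. Qed.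

Let mpre A : measurable A -> measurable (@rV_cons R n @^-1` A).
Proof.
by move=> mA; rewrite -[X in measurable X]setTI; exact: measurable_rV_cons.
Qed.

Let mu_ge0 A : 0 <= rV_product A.
Proof. exact: (@measure_ge0 _ _ _ (@lebesgue_measure R \x m)). Qed.

Let mu_sigma_additive : semi_sigma_additive rV_product.
Proof.
move=> F mF tF mUF; rewrite /rV_product /pushforward preimage_bigcup.
apply: measure_semi_sigma_additive => [i||]; first exact: mpre.
- apply/trivIsetP => /= i j _ _ ij; rewrite -preimage_setI.
  by move/trivIsetP : tF => /(_ _ _ _ _ ij) ->//; rewrite preimage_set0.
- by rewrite -preimage_bigcup; exact: mpre.
Qed.

HB.instance Definition _ := isMeasure.Build _ _ _ rV_product
  mu0 mu_ge0 mu_sigma_additive.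

Let mu_sigma_finite : sigma_finite setT rV_product.
Proof.
have /sigma_finiteP[F [TF ndF Foo]] := sigma_finiteT (@lebesgue_measure R).
have /sigma_finiteP[G [TG ndG Goo]] := sigma_finiteT m.
exists (fun i => @rV_uncons R n @^-1` (F i `*` G i)).
  rewrite predeqE => x; split => // _.
  have [i _ Fi] : (\bigcup_i F i) (x ord0 ord0) by rewrite -TF.
  have [j _ Gj] : (\bigcup_i G i) (rV_uncons x).2 by rewrite -TG.
  exists (maxn i j) => //; split.
  - by move: Fi; exact/subsetPset/ndF/leq_maxl.
  - by move: Gj; exact/subsetPset/ndG/leq_maxr.
move=> i; have [mF Fi] := Foo i; have [mG Gi] := Goo i.
have mFG : measurable (F i `*` G i) by exact: measurableX.
split; first by rewrite -[X in measurable X]setTI; exact: measurable_rV_uncons.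
rewrite /rV_product /pushforward -comp_preimage.
rewrite (_ : _ \o _ = id); last by apply/funext => p /=; rewrite rV_consK.
rewrite preimage_id product_measure1E//.
by rewrite lte_mul_pinfty// ge0_fin_numE.
Qed.

HB.instance Definition _ := Measure_isSigmaFinite.Build _ _ _ rV_product
  mu_sigma_finite.

End rV_lebesgue_step.

Fixpoint rV_lebesgue (R : realType) (n : nat) :
    {sigma_finite_measure set 'rV[R]_n -> \bar R} :=
  match n with
  | 0%N => \d_ (0 : 'rV[R]_0)
  | n'.+1 => rV_product (rV_lebesgue R n')
  end.

Lemma measurable_rV_box (R : realType) n (A : 'I_n -> set R) :
  (forall i, measurable (A i)) ->
  measurable [set x : 'rV[R]_n | forall i, A i (x ord0 i)].
Proof.
move=> mA; have -> : [set x : 'rV[R]_n | forall i, A i (x ord0 i)] =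
    \bigcap_(i in [set: 'I_n]) (rV_coord i @^-1` A i).
  by apply/seteqP; split => x /= Ax i; [move=> _; exact: Ax|exact: Ax].
apply: fin_bigcap_measurable => // i _.
by rewrite -[X in measurable X]setTI; exact: measurable_rV_coord.
Qed.

Lemma rV_lebesgue_box (R : realType) n (A : 'I_n -> set R) :
  (forall i, measurable (A i)) ->
  rV_lebesgue R n [set x | forall i, A i (x ord0 i)] =
  (\prod_(i < n) lebesgue_measure (A i))%E.
Proof.
elim: n A => [|n IH] A mA.
  by rewrite big_ord0 /= diracE mem_set// => -[].
pose A' i := A (lift ord0 i); have mA' i : measurable (A' i) by exact: mA.
rewrite big_ord_recl -(IH A')// -product_measure1E//.
- rewrite [LHS]/= /rV_product /pushforward; congr (product_measure1 _ _ _).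
  apply/seteqP; split => -[a x] /=.
    move=> Ax; split; first by have := Ax ord0; rewrite mxE unlift_none.
    by move=> i; have := Ax (lift ord0 i); rewrite mxE liftK.
  by move=> [Aa Ax] i; rewrite mxE; case: unliftP => [j|] ->; [exact: Ax|].
- exact: mA.
- exact: measurable_rV_box.
Qed.

(* A point of R x R^n x R^(n^{(x)2})_s x ... x R^(n^{(x)k})_s is stored as one
   array X indexed by all words s over {0..n-1} of length at most k: the
   entries with [size s = j] form the j-tensor X_j, and invariance under
   permutation of the word says that every X_j is symmetric. *)

Definition symmetric_words (R : realType) (n k : nat) :
    {pred {ffun k.-bseq 'I_n -> R}} :=
  [pred X : {ffun k.-bseq 'I_n -> R} |
    [forall s : k.-bseq 'I_n, forall t : k.-bseq 'I_n,
      perm_eq s t ==> (X s == X t)]].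
Arguments symmetric_words : clear implicits.

Lemma symmetric_wordsP (R : realType) (n k : nat)
    (X : {ffun k.-bseq 'I_n -> R}) :
  reflect (forall s t : k.-bseq 'I_n, perm_eq s t -> X s = X t)
          (X \in symmetric_words R n k).
Proof.
apply: (iffP 'forall_forallP) => XE s t.
  by move=> st; exact/eqP/(implyP (XE s t)).
by apply/implyP => st; apply/eqP; exact: XE.
Qed.

Lemma symmetric_words_submod (R : realType) (n k : nat) :
  submod_closed (symmetric_words R n k).
Proof.
split; first by apply/symmetric_wordsP => s t _; rewrite !ffunE.
move=> a X Y /symmetric_wordsP XE /symmetric_wordsP YE.
by apply/symmetric_wordsP => s t st; rewrite !ffunE (XE _ _ st) (YE _ _ st).
Qed.

HB.instance Definition _ (R : realType) (n k : nat) :=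
  GRing.isSubmodClosed.Build R {ffun k.-bseq 'I_n -> R} (symmetric_words R n k)
    (@symmetric_words_submod R n k).

Record jet (R : realType) (n k : nat) := Jet {
  jet_entries :> {ffun k.-bseq 'I_n -> R};
  jet_symmetric : jet_entries \in symmetric_words R n k }.

HB.instance Definition _ (R : realType) (n k : nat) :=
  [isSub for @jet_entries R n k].
HB.instance Definition _ (R : realType) (n k : nat) :=
  [Choice of jet R n k by <:].
HB.instance Definition _ (R : realType) (n k : nat) :=
  [SubChoice_isSubLmodule of jet R n k by <:].

Section jet_norm.
Context {R : realType} (n k : nat).

Definition jet_norm (X : jet R n k) : R :=
  \big[Num.max/0]_(s : k.-bseq 'I_n) `|X s|.

Let jet_normD X Y : jet_norm (X + Y) <= jet_norm X + jet_norm Y.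
Proof.
apply/bigmax_leP; split => [|s _]; first by rewrite addr_ge0// bigmax_ge_id.
by rewrite ffunE (le_trans (ler_normD _ _))// lerD// le_bigmax.
Qed.

Let jet_normZ a X : jet_norm (a *: X) = `|a| * jet_norm X.
Proof.
rewrite /jet_norm; apply: (big_ind2 (fun x y => x = `|a| * y)).
- by rewrite mulr0.
- by move=> ? x ? y -> ->; rewrite maxr_pMr.
- by move=> s _; rewrite ffunE normrM.
Qed.

Let jet_norm_eq0 X : jet_norm X = 0 -> X = 0.
Proof.
move=> X0; apply/val_inj/ffunP => s; rewrite ffunE; apply/eqP.
by rewrite -normr_eq0 eq_le normr_ge0 andbT -X0 le_bigmax.
Qed.

HB.instance Definition _ := @Lmodule_isNormed.Build R (jet R n k)
  jet_norm jet_normD jet_normZ jet_norm_eq0.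
End jet_norm.

Section tensors.
Context {R : realType} (n k : nat).
Implicit Types G T : {ffun k.-tuple 'I_n -> R}.

Definition tensor_dot G T : R := \sum_(s : k.-tuple 'I_n) G s * T s.

Definition tensor_pow (a : 'rV[R]_n) : {ffun k.-tuple 'I_n -> R} :=
  [ffun s : k.-tuple 'I_n => \prod_(i < k) a ord0 (tnth s i)].

Lemma jet_of_subproof (F : seq 'I_n -> R) :
  [ffun s : k.-bseq 'I_n => F (sort (fun i j : 'I_n => (i <= j)%N) s)]
    \in symmetric_words R n k.
Proof.
apply/symmetric_wordsP => s t st; rewrite !ffunE; congr F.
apply/perm_sortP => //.
- by move=> i j; exact: leq_total.
- by move=> i j l; exact: leq_trans.
- by move=> i j ij; apply/val_inj/anti_leq.
Qed.

(* The symmetric jet with entry F s at each non-decreasing word s. *)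
Definition jet_of (F : seq 'I_n -> R) : jet R n k := Jet (jet_of_subproof F).

Lemma jet_top_subproof T :
  [ffun s : k.-bseq 'I_n =>
     (\sum_(t : k.-tuple 'I_n | perm_eq t s) T t)
       / #|[pred t : k.-tuple 'I_n | perm_eq t s]|%:R]
    \in symmetric_words R n k.
Proof.
apply/symmetric_wordsP => s t st; rewrite !ffunE.
have E r : perm_eq r s = perm_eq r t by exact/(permPr st).
congr (_ / _%:R); first exact: eq_bigl.
by apply: eq_card => r; rewrite !inE E.
Qed.

(* The point (0,...,0,Sym T), where Sym T is the orthogonal projection of the
   k-tensor T onto the symmetric tensors (the sum is empty if size s < k). *)
Definition jet_top T : jet R n k := Jet (jet_top_subproof T).

(* H_{,X_k}(x,X), the gradient of H(x,X_0,...,X_{k-1},.) for the Euclidean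
   inner product of symmetric tensors: since it is symmetric, its entry s is
   its inner product with Sym (e_{s_1} (x) ... (x) e_{s_k}). *)
Definition grad_top (H : 'rV[R]_n * jet R n k -> R) (x : 'rV[R]_n)
    (X : jet R n k) : {ffun k.-tuple 'I_n -> R} :=
  [ffun s : k.-tuple 'I_n =>
     'D_((0, jet_top [ffun t => (t == s)%:R]) : 'rV[R]_n * jet R n k) H (x, X)].

Lemma jet_top_linear a T T' :
  jet_top (a *: T + T') = a *: jet_top T + jet_top T'.
Proof.
apply/val_inj/ffunP => s; rewrite !ffunE /GRing.scale/= mulrA -mulrDl; congr (_ / _).
by rewrite mulr_sumr -big_split; apply: eq_bigr => t _; rewrite !ffunE.
Qed.

Lemma grad_topP H x X T : differentiable H (x, X) ->
  tensor_dot (grad_top H x X) T = 'D_(0, jet_top T) H (x, X).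
Proof.
move=> dH; rewrite deriveE//.
pose L T := 'd H (x, X) (0, jet_top T).
have LD a U V : L (a *: U + V) = a * L U + L V.
  rewrite /L jet_top_linear -[in RHS]linearZ -linearD; congr ('d H (x, X) _).
  by congr pair; apply/rowP => i; rewrite !mxE mulr0 addr0.
have L0 : L 0 = 0.
  by have := LD (-1) 0 0; rewrite scaler0 add0r mulN1r addNr.
have Lsum r : L (\sum_(s <- r) T s *: [ffun t => (t == s)%:R]) =
    \sum_(s <- r) T s * L [ffun t => (t == s)%:R].
  by elim: r => [|s r IH]; rewrite ?big_nil ?L0// !big_cons LD IH.
have TE : T = \sum_s T s *: [ffun t => (t == s)%:R].
  apply/ffunP => t; rewrite sum_ffunE (bigD1 t)//= !ffunE eqxx.
  rewrite big1 ?addr0 => [|s st]; first by rewrite /GRing.scale/= mulr1.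
  by rewrite !ffunE eq_sym (negbTE st) /GRing.scale/= mulr0.
rewrite -/(L T) [in RHS]TE Lsum; apply: eq_bigr => s _.
by rewrite ffunE deriveE// mulrC.
Qed.

End tensors.

Section derivatives.
Context {R : realType} (n : nat).
Implicit Types (D O : set 'rV[R]_n) (f g : 'rV[R]_n -> R) (s : seq 'I_n).

Definition partial (i : 'I_n) f : 'rV[R]_n -> R :=
  fun x => 'D_(delta_mx ord0 i) f x.

Definition partials s f : 'rV[R]_n -> R := foldr partial f s.

Definition gradient f (x : 'rV[R]_n) : 'rV[R]_n := \row_i partial i f x.

(* C^m(D) for D open: all partial derivatives of order <= m exist and are
   continuous in D.  The values of f off D are irrelevant. *)
Definition continuously_differentiable (m : nat) D f :=
  forall s, (size s <= m)%N ->
    (forall x, D x -> {for x, continuous (partials s f)}) /\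
    ((size s < m)%N ->
       forall i x, D x -> derivable (partials s f) x (delta_mx ord0 i)).

Definition support f : set 'rV[R]_n := closure [set x | f x != 0].

Definition compactly_supported D f :=
  compact (support f) /\ support f `<=` D.

Definition test_function D (eta : 'rV[R]_n -> R) :=
  (forall m, continuously_differentiable m setT eta) /\
  compactly_supported D eta.

Definition locally_integrable_on D f :=
  forall K, compact K -> K `<=` D ->
    (rV_lebesgue R n).-integrable K (EFin \o f).

Definition weak_partial D s f g :=
  [/\ locally_integrable_on D f, locally_integrable_on D g &
      forall eta, test_function D eta ->
        \int[rV_lebesgue R n]_(x in D) (f x * partials s eta x) =
        (-1) ^+ size s * \int[rV_lebesgue R n]_(x in D) (g x * eta x)].

Definition ess_sup_on O (f : 'rV[R]_n -> R) : \bar R :=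
  ess_sup (rV_lebesgue R n) (fun x => if x \in O then (f x)%:E else -oo%E).

End derivatives.

Section supremal_functional.
Context {R : realType} (n k : nat).
Implicit Types (Omega O : set 'rV[R]_n) (u v phi : 'rV[R]_n -> R).
Implicit Types (H : 'rV[R]_n * jet R n k -> R).

(* The classical jet (u, Du, ..., D^k u) at x.  For u in C^k the mixed partials
   do not depend on the order of differentiation. *)
Definition classical_jet u (x : 'rV[R]_n) : jet R n k :=
  jet_of k (fun s => partials s u x).

(* V is a version of (v, Dv, ..., D^k v), derivatives in the weak sense. *)
Definition weak_jet Omega v (V : 'rV[R]_n -> jet R n k) :=
  forall s : k.-bseq 'I_n, weak_partial Omega s v (fun x => V x s).

(* phi in W^{k,oo}_c(Omega), extended by 0 off Omega.  For k >= 1 an element of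
   W^{k,oo} has a unique continuous representative, which is the one meant by
   the open set {phi <> 0}. *)
Definition sobolev_infty_c Omega phi :=
  [/\ continuous phi, compactly_supported Omega phi &
      exists2 V, weak_jet Omega phi V &
        exists M : R, {ae rV_lebesgue R n, forall x, Omega x ->
          forall s : k.-bseq 'I_n, `|V x s| <= M}].

(* E_oo(v, O) = e.  The value does not depend on the version V, weak
   derivatives being unique almost everywhere. *)
Definition E_infty H Omega v O (e : \bar R) :=
  exists2 V, weak_jet Omega v V &
    e = ess_sup_on O (fun x => H (x, V x)).

(* (DE_oo)^+_u(phi) = l. *)
Definition total_semidifferential H Omega u phi (l : \bar R) :=
  let O := [set x | phi x != 0] in
  (phi = cst 0 -> l = 0%E) /\
  (phi <> cst 0 -> exists e : R -> \bar R,
    (forall t, 0 <= t -> E_infty H Omega (fun x => u x + t * phi x) O (e t)) /\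
    ((e t - e 0%R) * (t^-1)%:E)%E @[t --> 0^'+] --> l).

(* H in C^1(Omega x R x R^n x ... ); in finite dimension, continuity of dH is
   continuity of dH(w) for every direction w. *)
Definition C1_on_jets Omega H :=
  forall p : 'rV[R]_n * jet R n k, Omega p.1 ->
    differentiable H p /\
    forall w : 'rV[R]_n * jet R n k, {for p, continuous (fun q => 'd H q w)}.

End supremal_functional.

(* Main.v *)
From HB Require Import structures.
From mathcomp Require Import all_boot all_order all_algebra.
From mathcomp Require Import all_classical all_reals all_analysis.
From mathcomp Require Import measurable_realfun ess_sup_inf ring lra.
Require Import Defs.

(* Suppose the tensor product does not vanish at x0, and let a be the gradient
   of f = H(., D^k u) at x0.  The test function is
   sigma * (|a|^2 - |(x - x0) / rho|^2)_+ ^ k, whose support is a Euclidean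
   ball of radius rho |a|: its derivatives of order k are bounded but jump
   across the sphere.  By Danskin's theorem the semi-differential is the maximum
   of H_X : D^k phi over the points of the closed ball where f is maximal.
   As rho -> 0 these points, rescaled, tend to a, where the derivatives of the
   profile of order less than k vanish and that of order k is
   sigma k! (-2)^k a^{(x)k}; hence rho^k times the semi-differential tends to
   sigma k! (-2)^k H_{,X_k} : a^{(x)k}, which is negative for a suitable
   sigma. *)

Set Implicit Arguments.
Unset Strict Implicit.
Unset Printing Implicit Defensive.
Import Order.TTheory GRing.Theory Num.Theory.
Import numFieldNormedType.Exports.
Local Open Scope classical_set_scope.
Local Open Scope ring_scope.

(** * Lebesgue measure on row vectors *)

(** The jump in the derivatives of order k is forced. Since D f is non-zero near x0, f attains its
    maximum over a small closed ball on the sphere, and a test function of class C^k that vanishes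
    outside the ball has zero k-jet there: it would only give 0 >= 0. With the power k, the
    derivatives of order below k still vanish on the sphere, so that the truncation has bounded weak
    derivatives up to order k, while those of order k do not all vanish. The maximum point is never
    determined: its rescaling only has to be near a, because the scaled differential is continuous
    and negative in the limit. The ball is Euclidean because roundness makes a the only maximiser of
    nu -> a . nu over the ball of radius |a|; with this radius the limit is a itself rather than
    a/|a|, and the gradient -2 nu of the profile produces the tensor power. The price of a
    non-smooth test function is that E_oo has to be evaluated through weak jets: hence the
    integration by parts on lines, and the comparison of an essential supremum over the open ball
    with a maximum over the closed one. *)

Section rV_borel.
Context {R : realType} (n : nat).
Implicit Types (x y : 'rV[R]_n) (A D K : set 'rV[R]_n).

Lemma norm_rV_le x (e : R) : 0 <= e ->
  (`|x| <= e) = [forall i, `|x ord0 i| <= e].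
Proof.
move=> e0; rewrite [`|x|]mx_normrE; apply/bigmax_leP/forallP.
  by move=> [_ h] i; exact: (h (ord0, i)).
by move=> h; split=> // -[j i] _ /=; rewrite ord1.
Qed.

Lemma norm_rV_coord x i : `|x ord0 i| <= `|x|.
Proof. by have := lexx `|x|; rewrite {1}norm_rV_le// => /forallP. Qed.

(** The sigma-algebra is generated by the coordinates, not by the open sets. An open set is the
    union of the boxes with rational corners that it contains, and there are countably many of
    them. *)
Lemma rV_open_measurable A : open A -> measurable A.
Proof.
move=> oA.
pose box (p : 'rV[rat]_n * 'rV[rat]_n) : set 'rV[R]_n :=
  [set x | forall i, x ord0 i \in `]ratr (p.1 ord0 i), ratr (p.2 ord0 i)[].
have mbox p : measurable (box p).
  exact: (measurable_rV_box (fun i => measurable_itv `]ratr (p.1 ord0 i), ratr (p.2 ord0 i)[)).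
rewrite (_ : A = \bigcup_(p in [set p | box p `<=` A]) box p).
  rewrite bigcup_mkcond; apply: countable_bigcupT_measurable => // p.
  by case: ifPn => // _; exact: measurable0.
apply/seteqP; split => [x Ax|x [p /= pA]]; last exact: pA.
have /nbhs_ballP[e /= e0 eA] : nbhs x A by exact: open_nbhs_nbhs.
have q1 i : {q : rat | ratr q \in `]x ord0 i - e / 2, x ord0 i[}.
  by apply/cid/rat_in_itvoo; rewrite ltrBlDr ltrDl divr_gt0.
have q2 i : {q : rat | ratr q \in `]x ord0 i, x ord0 i + e / 2[}.
  by apply/cid/rat_in_itvoo; rewrite ltrDl divr_gt0.
exists (\row_i sval (q1 i), \row_i sval (q2 i)) => /=.
  move=> y /= yb; apply: eA; rewrite -ball_normE /=.
  apply: (@le_lt_trans _ _ (e / 2)); last by rewrite ltr_pdivrMr// ltr_pMr// ltr1n.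
  rewrite norm_rV_le ?divr_ge0 ?(ltW e0)//; apply/forallP => i.
  have := yb i; rewrite !mxE.
  case: (q1 i) (q2 i) => /= a + [b /=]; rewrite !in_itv/=.
  by rewrite ler_norml => *; lra.
move=> i /=; rewrite !mxE; case: (q1 i) (q2 i) => /= a + [b /=].
by rewrite !in_itv/= => *; lra.
Qed.

Lemma rV_closed_measurable A : closed A -> measurable A.
Proof. by move/closed_openC/rV_open_measurable/measurableC; rewrite setCK. Qed.

Lemma rV_compact_closed K : compact K -> closed K.
Proof. by apply: compact_closed; exact: norm_hausdorff. Qed.

Lemma rV_compact_measurable K : compact K -> measurable K.
Proof. by move=> /rV_compact_closed/rV_closed_measurable. Qed.

Lemma rV_continuous_measurable D (f : 'rV[R]_n -> R) : open D ->
  (forall x, D x -> {for x, continuous f}) -> measurable_fun D f.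
Proof.
move=> oD cf; apply: (measurability _ (measurable_realfun.RGenOpens.measurableE R)).
move=> _ [_ [a [b ->] <-]]; apply: rV_open_measurable.
rewrite openE => x [Dx fx]; apply: filterI; first exact: open_nbhs_nbhs.
by apply: cf => //; apply: open_nbhs_nbhs; split => //; exact: interval_open.
Qed.

Lemma rV_compact_box K : compact K ->
  exists2 B : R, 0 < B & forall x, K x -> `|x| <= B.
Proof.
move=> /compact_bounded /ex_strict_bound_gt0 [B B0 hB]; exists B => // x Kx.
by have /ltW := hB _ Kx.
Qed.

Lemma rV_ballE (B : R) : 0 <= B -> [set x : 'rV[R]_n | `|x| <= B] =
  [set x | forall i, `[- B, B]%classic (x ord0 i)].
Proof.
move=> B0; apply/seteqP; split => x /=; rewrite norm_rV_le//.
  by move=> /forallP h i; rewrite in_itv/= -ler_norml.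
by move=> h; apply/forallP => i; have := h i; rewrite in_itv/= -ler_norml.
Qed.

Lemma measurable_rV_ball (B : R) : 0 <= B ->
  measurable [set x : 'rV[R]_n | `|x| <= B].
Proof.
move=> B0; rewrite rV_ballE//.
by apply: (@measurable_rV_box R n (fun=> `[- B, B]%classic)) => i; exact: measurable_itv.
Qed.

Lemma rV_lebesgue_ball (B : R) : 0 <= B ->
  (rV_lebesgue R n [set x : 'rV[R]_n | (`|x| <= B)%R] < +oo)%E.
Proof.
move=> B0; rewrite rV_ballE// (@rV_lebesgue_box R n (fun=> `[- B, B]%classic)).
  rewrite (eq_bigr (fun=> (B *+ 2)%:E)); first by rewrite prodEFin ltry.
  move=> i _; rewrite lebesgue_measure_itv /= lte_fin.
  case: ltP => [_|]; first by rewrite -EFinD opprK.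
  by move=> h; congr EFin; lra.
by move=> i; exact: measurable_itv.
Qed.

Lemma rV_lebesgue_open_gt0 A : open A -> A !=set0 ->
  (0 < rV_lebesgue R n A)%E.
Proof.
move=> oA [x Ax].
have /nbhs_ballP[e /= e0 eA] : nbhs x A by exact: open_nbhs_nbhs.
pose b i := `[x ord0 i - e / 2, x ord0 i + e / 2]%classic.
have mb i : measurable (b i) by exact: measurable_itv.
apply: (@lt_le_trans _ _ (rV_lebesgue R n [set y | forall i, b i (y ord0 i)])).
  rewrite (rV_lebesgue_box mb).
  rewrite (eq_bigr (fun=> e%:E)); first by rewrite prodEFin lte_fin prodr_gt0.
  move=> i _; rewrite lebesgue_measure_itv /= lte_fin ifT; last by lra.
  by rewrite -EFinD; congr EFin; lra.
apply: le_measure; rewrite ?inE//=.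
- exact: measurable_rV_box.
- exact: rV_open_measurable.
move=> y /= yb; apply: eA; rewrite -ball_normE /=.
apply: (@le_lt_trans _ _ (e / 2)); last by rewrite ltr_pdivrMr// ltr_pMr// ltr1n.
rewrite norm_rV_le ?divr_ge0 ?(ltW e0)//; apply/forallP => i.
by have := yb i; rewrite /b !mxE /= in_itv/= ler_norml => *; lra.
Qed.

End rV_borel.

(** * Integration along lines parallel to an axis *)

Section fubini_lines.
Context {R : realType}.

(** A class of integrable functions that is stable under freezing a coordinate, as the induction on
    the dimension in [integral_lines0] requires. *)
Definition bounded_cs n (G : 'rV[R]_n -> R) :=
  [/\ measurable_fun setT G, exists M, forall x, `|G x| <= M &
      exists2 B : R, 0 < B & forall x, G x != 0 -> `|x| <= B].

Definition rV_upd n (i : 'I_n) (x : 'rV[R]_n) (t : R) : 'rV[R]_n :=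
  \row_j if j == i then t else x ord0 j.

Lemma bounded_cs_integrable n (G : 'rV[R]_n -> R) : bounded_cs G ->
  (rV_lebesgue R n).-integrable setT (EFin \o G).
Proof.
move=> [mG [M GM] [B B0 GB]].
have mB := @measurable_rV_ball R n _ (ltW B0).
have : (rV_lebesgue R n).-integrable [set x | `|x| <= B] (EFin \o G).
  apply: measurable_bounded_integrable => //.
  - exact: rV_lebesgue_ball (ltW B0).
  - exact: measurable_funTS.
  - exists M; split=> [|r /ltW Mr x _]; first exact: num_real.
    exact: le_trans (GM x) Mr.
move=> /(integrable_mkcond _ mB).
apply: eq_integrable => // x _; rewrite patchE; case: ifPn => //=.
rewrite notin_setE /= => nB; congr EFin; apply/esym/eqP.
by apply: contra_notT nB => /GB.
Qed.

Lemma rV_upd_cons0 n (a t : R) (x : 'rV[R]_n) :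
  rV_upd ord0 (rV_cons (a, x)) t = rV_cons (t, x).
Proof.
by apply/rowP => j; rewrite !mxE; case: (unliftP ord0 j) => [k|] -> /=.
Qed.

Lemma rV_upd_cons_lift n (a t : R) (x : 'rV[R]_n) i :
  rV_upd (lift ord0 i) (rV_cons (a, x)) t = rV_cons (a, rV_upd i x t).
Proof.
apply/rowP => j; rewrite !mxE; case: (unliftP ord0 j) => [k|] -> //=.
by rewrite (inj_eq lift_inj) mxE.
Qed.

Lemma norm_rV_cons n (a : R) (x : 'rV[R]_n) B : 0 <= B ->
  (`|rV_cons (a, x)| <= B) = (`|a| <= B) && (`|x| <= B).
Proof.
move=> B0; rewrite !norm_rV_le//; apply/forallP/andP => [h|[ha /forallP hx] i].
  split; first by have := h ord0; rewrite mxE unlift_none.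
  by apply/forallP => i; have := h (lift ord0 i); rewrite mxE liftK.
by rewrite mxE; case: unliftP.
Qed.

Lemma measurable_rV_cons_l n (a : R) :
  measurable_fun setT (fun x : 'rV[R]_n => rV_cons (a, x)).
Proof. by apply: measurableT_comp => //; exact: measurable_rV_cons. Qed.

(** Induction on the dimension, since [rV_lebesgue] splits off the first coordinate. If [i] is that
    coordinate, Fubini integrates it first; otherwise it is frozen and the induction hypothesis
    applies to the remaining ones. *)
Lemma integral_lines0 n (G : 'rV[R]_n -> R) i : bounded_cs G ->
  (forall x, \int[lebesgue_measure]_t (G (rV_upd i x t))%:E = 0)%E ->
  (\int[rV_lebesgue R n]_x (G x)%:E = 0)%E.
Proof.
elim: n G i => [G [] //|n IH G i bG G0].
have iG := bounded_cs_integrable bG.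
have [mG [M GM] [B B0 GB]] := bG.
have /integrableP[mEG fG] := iG.
have mc : measurable_fun [set: measurableTypeR R * 'rV[R]_n] (@rV_cons R n).
  by move=> _ Y mY; exact: (measurable_rV_cons measurableT mY).
have iGc : (lebesgue_measure \x rV_lebesgue R n)%E.-integrable setT
    ((EFin \o G) \o @rV_cons R n).
  apply/integrableP; split.
    by move=> mT Y /(mEG measurableT); rewrite setTI => /(mc mT).
  have -> : (\int[lebesgue_measure \x rV_lebesgue R n]_x
     `|((EFin \o G) \o rV_cons (n:=n)) x| =
     \int[rV_lebesgue R n.+1]_x `|(EFin \o G) x|)%E; last by [].
  rewrite [RHS](ge0_integral_pushforward mc (lebesgue_measure \x rV_lebesgue R n)%E)//.
  exact: measurableT_comp.
have -> : (\int[rV_lebesgue R n.+1]_x (G x)%:E =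
    \int[lebesgue_measure \x rV_lebesgue R n]_p (G (rV_cons p))%:E)%E.
  exact: (integral_pushforward mc mEG iGc measurableT).
case: (unliftP ord0 i) => [j|] ij; rewrite ij in G0.
  rewrite -(integral12_prod_meas1 iGc) /fubini_F /=.
  rewrite (eq_integral (cst 0%E)) ?integral0// => a _.
  apply: (IH (fun x => G (rV_cons (a, x))) j).
    split.
    - by apply: measurableT_comp => //; exact: measurable_rV_cons_l.
    - by exists M => x; exact: GM.
    - by exists B => // x /GB; rewrite norm_rV_cons ?(ltW B0)// => /andP[].
  move=> x; rewrite -[RHS](G0 (rV_cons (a, x))).
  by apply: eq_integral => t _; rewrite rV_upd_cons_lift.
rewrite -(integral21_prod_meas1 iGc) /fubini_G /=.
rewrite (eq_integral (cst 0%E)) ?integral0// => x _.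
rewrite -[RHS](G0 (rV_cons (0, x))).
by apply: eq_integral => t _; rewrite rV_upd_cons0.
Qed.

End fubini_lines.

(** * Integration by parts and weak derivatives *)

Section lines.
Context {R : realType} (V : normedModType R).
Implicit Types (f : V -> R) (x v : V).

Lemma is_derive_line f x v (s : R) : derivable f (x + s *: v) v ->
  is_derive s 1 (fun t : R => f (x + t *: v)) ('D_v f (x + s *: v)).
Proof.
have E : (fun h : R => h^-1 *: (((fun t : R => f (x + t *: v)) \o shift s) (h *: 1) -
    f (x + s *: v))) = (fun h => h^-1 *: ((f \o shift (x + s *: v)) (h *: v) -
    f (x + s *: v))).
  apply/funext => h /=; congr (_ *: (f _ - _)).
  by rewrite [h *: 1]mulr1 scalerDl addrCA.
by move=> df; split; rewrite /derivable /derive E.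
Qed.

Lemma derivable_line_continuous f x v (s : R) : derivable f (x + s *: v) v ->
  {for s, continuous (fun t : R => f (x + t *: v))}.
Proof.
move=> /is_derive_line [df _].
by apply: differentiable_continuous; exact/derivable1_diffP.
Qed.

Lemma is_derive_translate f x w v df : is_derive (x + w) v f df ->
  is_derive x v (fun y => f (y + w)) df.
Proof.
have E : (fun h : R => h^-1 *: (((fun y => f (y + w)) \o shift x) (h *: v) -
    f (x + w))) = (fun h => h^-1 *: ((f \o shift (x + w)) (h *: v) - f (x + w))).
  by apply/funext => h /=; rewrite addrA.
by move=> [df1 <-]; split; rewrite /derivable /derive E.
Qed.

End lines.

Lemma is_deriveM_dir (R : realType) (V : normedModType R) (f g : V -> R)
    (x v : V) (df dg : R) : is_derive x v f df -> is_derive x v g dg ->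
  is_derive x v (fun y => f y * g y) (f x * dg + df * g x).
Proof.
move=> [df1 <-] [dg1 <-]; have := @is_deriveM _ _ f g x v _ _ (derivableP df1) (derivableP dg1).
by rewrite /GRing.scale /= [g x * _]mulrC.
Qed.

Section test_functions.
Context {R : realType} (n : nat).
Implicit Types (D K : set 'rV[R]_n) (f g eta : 'rV[R]_n -> R) (i : 'I_n).

Lemma support_sub f x : ~ support f x -> f x = 0.
Proof.
move=> sx; apply/eqP/negP => fx; apply: sx; apply: subset_closure => /=.
exact/negP.
Qed.

Lemma support_near f x : ~ support f x -> \forall y \near x, f y = 0.
Proof.
move=> sx; have oS : open (~` support f) by apply: closed_openC; exact: closed_closure.
have : nbhs x (~` support f) by exact: open_nbhs_nbhs.
by apply: filterS => y; exact: support_sub.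
Qed.

Lemma partial_off_support f i x : ~ support f x -> partial i f x = 0.
Proof.
move=> /support_near fx; rewrite /partial (@near_eq_derive _ _ _ f (cst 0)) //.
by rewrite derive_cst.
Qed.

Lemma support_partial f i : support (partial i f) `<=` support f.
Proof.
rewrite /support [X in X `<=` _]closureE; apply: smallest_sub.
  exact: closed_closure.
by move=> x /= /eqP; apply: contra_notP => /partial_off_support.
Qed.

Lemma test_function_cont D eta : test_function D eta -> continuous eta.
Proof. by move=> [/(_ 0%N [::] isT)[+ _] _] x; exact. Qed.

Lemma test_function_derivable D eta i x : test_function D eta ->
  derivable eta x (delta_mx ord0 i).
Proof. by move=> [/(_ 1%N [::] isT)[_ +] _]; exact. Qed.

Lemma partials_rcons (s : seq 'I_n) i f : partials (rcons s i) f = partials s (partial i f).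
Proof. by rewrite /partials -cats1 foldr_cat. Qed.

Lemma test_function_partial D eta i : test_function D eta ->
  test_function D (partial i eta).
Proof.
move=> [seta [ceta seD]]; split.
  move=> m s sm; have := seta m.+1 (rcons s i); rewrite partials_rcons size_rcons; exact.
split; last exact: subset_trans (@support_partial _ _) seD.
apply: subclosed_compact ceta (@support_partial _ _).
exact: closed_closure.
Qed.

Lemma test_function_partials D eta s : test_function D eta ->
  test_function D (partials s eta).
Proof. by move=> tD; elim: s => //= i s; exact: test_function_partial. Qed.

End test_functions.

Section loc_bounded.
Context {R : realType} (n : nat).
Implicit Types (D K : set 'rV[R]_n) (f g eta : 'rV[R]_n -> R) (i : 'I_n).

(** Weak enough to contain truncations that jump across a sphere, strong enough to give
    integrability against every test function. *)
Definition loc_bounded D f := measurable_fun D f /\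
  forall K, compact K -> K `<=` D -> exists M : R, forall x, K x -> `|f x| <= M.

Lemma continuous_loc_bounded D f : open D ->
  (forall x, D x -> {for x, continuous f}) -> loc_bounded D f.
Proof.
move=> oD cf; split; first exact: rV_continuous_measurable.
move=> K cK KD; have : compact (f @` K).
  apply: continuous_compact => //; apply: continuous_in_subspaceT => x /set_mem Kx.
  by apply: cf; exact: KD.
move=> /compact_bounded /ex_strict_bound_gt0 [M M0 hM]; exists M => x Kx.
by have /ltW := hM (f x) (ex_intro2 _ _ x Kx erefl).
Qed.

Lemma loc_boundedM D f g : loc_bounded D f -> loc_bounded D g ->
  loc_bounded D (fun x => f x * g x).
Proof.
move=> [mf bf] [mg bg]; split; first exact: measurable_funM.
move=> K cK KD; have [M fM] := bf _ cK KD; have [N gN] := bg _ cK KD.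
by exists (M * N) => x Kx; rewrite normrM ler_pM ?normr_ge0 ?fM ?gN.
Qed.

Lemma loc_boundedD D f g : loc_bounded D f -> loc_bounded D g ->
  loc_bounded D (fun x => f x + g x).
Proof.
move=> [mf bf] [mg bg]; split; first exact: measurable_funD.
move=> K cK KD; have [M fM] := bf _ cK KD; have [N gN] := bg _ cK KD.
by exists (M + N) => x Kx; rewrite (le_trans (ler_normD _ _))// lerD ?fM ?gN.
Qed.

Lemma loc_boundedZ D (c : R) f : loc_bounded D f -> loc_bounded D (fun x => c * f x).
Proof.
move=> [mf bf]; split; first by apply: measurable_funM => //; exact: measurable_cst.
move=> K cK KD; have [M fM] := bf _ cK KD.
by exists (`|c| * M) => x Kx; rewrite normrM ler_wpM2l ?fM.
Qed.

Lemma rV_lebesgue_compact K : compact K -> (rV_lebesgue R n K < +oo)%E.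
Proof.
move=> cK; have [B B0 KB] := rV_compact_box cK.
apply: le_lt_trans (@rV_lebesgue_ball R n _ (ltW B0)).
apply: le_measure; rewrite ?inE//; first exact: rV_compact_measurable.
exact: measurable_rV_ball (ltW B0).
Qed.

Lemma loc_bounded_integrable D f : open D -> loc_bounded D f ->
  locally_integrable_on D f.
Proof.
move=> oD [mf bf] K cK KD; have [M fM] := bf _ cK KD.
apply: measurable_bounded_integrable.
- exact: rV_compact_measurable.
- exact: rV_lebesgue_compact.
- by apply: measurable_funS mf => //; exact: rV_open_measurable.
- exists M; split=> [|r /ltW Mr x Kx]; first exact: num_real.
  exact: le_trans (fM _ Kx) Mr.
Qed.

Lemma loc_bounded_cs D f eta : open D -> loc_bounded D f ->
  compactly_supported D eta -> continuous eta ->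
  bounded_cs ((fun x => f x * eta x) \_ D).
Proof.
move=> oD bf [ceta etaD] eta_c.
have [mfe bfe] := loc_boundedM bf (continuous_loc_bounded oD (fun x _ => eta_c x)).
have [M fM] := bfe _ ceta etaD; have [B B0 eB] := rV_compact_box ceta.
split.
- by apply/(measurable_restrictT _ _).1 => //; exact: rV_open_measurable.
- exists `|M| => x; rewrite patchE; case: ifPn => _; last by rewrite normr0.
  have [sx|/support_sub ->] := pselect (support eta x).
    by rewrite (le_trans (fM _ sx))// ler_norm.
  by rewrite mulr0 normr0.
- exists B => // x; rewrite patchE; case: ifPn => _; last by rewrite eqxx.
  move=> fe; apply: eB; apply: contrapT => /support_sub e0.
  by rewrite e0 mulr0 eqxx in fe.
Qed.

Lemma bounded_csD f g : bounded_cs f -> bounded_cs g ->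
  bounded_cs (fun x => f x + g x).
Proof.
move=> [mf [M fM] [A A0 fA]] [mg [N gN] [B B0 gB]]; split.
- exact: measurable_funD.
- by exists (M + N) => x; rewrite (le_trans (ler_normD _ _))// lerD.
- exists (Num.max A B); first by rewrite lt_max A0.
  move=> x fg; rewrite le_max; apply/orP.
  have [f0|/fA] := eqVneq (f x) 0; last by left.
  by right; apply: gB; move: fg; rewrite f0 add0r.
Qed.

Lemma loc_bounded_mul_integrable D f eta : open D -> loc_bounded D f ->
  compactly_supported D eta -> continuous eta ->
  (rV_lebesgue R n).-integrable D (EFin \o (fun x => f x * eta x)).
Proof.
move=> oD bf cse ce; apply/integrable_mkcond; first exact: rV_open_measurable.
rewrite restrict_EFin; apply: bounded_cs_integrable.
exact: loc_bounded_cs.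
Qed.

(** The identity in [weak_partial] for a single derivative; higher orders are obtained by iterating
    it. *)
Definition integral_by_parts D i f g := forall eta, test_function D eta ->
  \int[rV_lebesgue R n]_(x in D) (f x * partial i eta x) =
  - \int[rV_lebesgue R n]_(x in D) (g x * eta x).

Lemma integral_by_parts_lines D i f g : open D ->
  loc_bounded D f -> loc_bounded D g ->
  (forall eta, test_function D eta -> forall x,
    \int[lebesgue_measure]_t
     (((fun y => f y * partial i eta y) \_ D) (rV_upd i x t) +
      ((fun y => g y * eta y) \_ D) (rV_upd i x t))%:E = 0)%E ->
  integral_by_parts D i f g.
Proof.
move=> oD bf bg H0 eta teta.
have teta' := test_function_partial i teta.
have cs1 := loc_bounded_cs oD bf teta'.2 (test_function_cont teta').
have cs2 := loc_bounded_cs oD bg teta.2 (test_function_cont teta).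
have /(congr1 fine) /= I0 := integral_lines0 (bounded_csD cs1 cs2) (H0 _ teta).
apply/eqP; rewrite -subr_eq0 opprK; apply/eqP; rewrite -[RHS]I0 !(Rintegral_mkcond _ D).
rewrite -RintegralD//; exact: bounded_cs_integrable.
Qed.

End loc_bounded.

(** * Symmetry of mixed partial derivatives *)

Section schwarz.
Context {R : realType} (n : nat).
Implicit Types (D : set 'rV[R]_n) (f : 'rV[R]_n -> R) (i j : 'I_n).
Local Notation e i := (delta_mx ord0 i : 'rV[R]_n).

Lemma norm_delta_mx i : `|e i| <= 1 :> R.
Proof.
rewrite norm_rV_le//; apply/forallP => j; rewrite mxE eqxx /=.
by case: (j == i); rewrite ?normr1 ?normr0.
Qed.

Lemma MVT_line f x v (h : R) : 0 < h ->
  (forall t, 0 <= t <= h -> derivable f (x + t *: v) v) ->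
  exists2 c, 0 < c < h & f (x + h *: v) - f x = h * 'D_v f (x + c *: v).
Proof.
move=> h0 df.
have [||c /=] := @MVT R (fun t => f (x + t *: v)) (fun t => 'D_v f (x + t *: v)) 0 h h0.
- move=> t; rewrite in_itv /= => /andP[t0 th]; apply: is_derive_line; apply: df.
  by rewrite !ltW.
- apply: continuous_in_subspaceT => t /set_mem /=; rewrite in_itv /= => th.
  by apply: derivable_line_continuous; exact: df.
rewrite in_itv /= scale0r addr0 subr0 mulrC => ch E; by exists c.
Qed.

(** Two applications of the mean value theorem: in the direction [e i] to the increment [g] of [f]
    along [h *: e j], then in the direction [e j] to [partial i f]. *)
Lemma second_difference f x i j (h : R) : 0 < h ->
  (forall s t, 0 <= s <= h -> 0 <= t <= h ->
     derivable f (x + s *: e i + t *: e j) (e i) /\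
     derivable (partial i f) (x + s *: e i + t *: e j) (e j)) ->
  exists s t, [/\ 0 < s < h, 0 < t < h &
    f (x + h *: e i + h *: e j) - f (x + h *: e i) - f (x + h *: e j) + f x =
    h * (h * partial j (partial i f) (x + s *: e i + t *: e j))].
Proof.
move=> h0 df; have hh : 0 <= h <= h by rewrite (ltW h0) lexx.
have zh : 0 <= (0 : R) <= h by rewrite (ltW h0) lexx.
pose g y := f (y + h *: e j) - f y.
have dg t : 0 <= t <= h -> is_derive (x + t *: e i) (e i) g
    (partial i f (x + t *: e i + h *: e j) - partial i f (x + t *: e i)).
  move=> th; have [d1 _] := df t h th hh; have [d2 _] := df t 0 th zh.
  rewrite scale0r addr0 in d2.
  apply: is_deriveB; last exact: derivableP.
  exact: (@is_derive_translate _ _ f (x + t *: e i) (h *: e j) (e i) _ (derivableP d1)).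
have [c cin E1] := @MVT_line g x (e i) h h0 (fun t th => (dg t th).(ex_derive)).
have ch : 0 <= c <= h by case/andP: cin => ? ?; rewrite !ltW.
have [d din E2] := @MVT_line (partial i f) (x + c *: e i) (e j) h h0
  (fun t th => (df c t ch th).2).
exists c, d; split => //; rewrite -[partial j _ _]/('D_(e j) (partial i f) _) -E2.
rewrite (@derive_val _ _ _ _ _ _ _ (dg c ch)) /g in E1.
by rewrite -E1; ring.
Qed.

(** The second difference of [f] is symmetric in [i] and [j], so the two mixed derivatives agree at
    two points that may differ but are both close to [x]; continuity at [x] does the rest. *)
Lemma partial_comm D f i j x : open D -> D x ->
  (forall y, D y -> derivable f y (e i) /\ derivable f y (e j)) ->
  (forall y, D y -> derivable (partial i f) y (e j) /\ derivable (partial j f) y (e i)) ->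
  {for x, continuous (partial j (partial i f))} ->
  {for x, continuous (partial i (partial j f))} ->
  partial j (partial i f) x = partial i (partial j f) x.
Proof.
move=> oD Dx df ddf cA cB; apply/eqP; rewrite -subr_eq0 -normr_le0.
apply/ler_addgt0Pl => eps eps0; rewrite addr0.
have e20 : 0 < eps / 2 by rewrite divr_gt0.
have /nbhs_ballP[d /= d0 hd] : nbhs x (D `&`
  ([set y | `|partial j (partial i f) x - partial j (partial i f) y| < eps / 2] `&`
   [set y | `|partial i (partial j f) x - partial i (partial j f) y| < eps / 2])).
  apply: filterI; first exact: open_nbhs_nbhs.
  by apply: filterI; [move/cvgr_dist_lt : cA|move/cvgr_dist_lt : cB]; exact.
(* Both points lie within 2 h of [x], hence strictly inside the ball of radius [d]. *)
pose h := d / 3.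
have h0 : 0 < h by rewrite divr_gt0.
have ballP a b s t : 0 <= s <= h -> 0 <= t <= h -> ball x d (x + s *: e a + t *: e b).
  move=> /andP[s0 sh] /andP[t0 th]; rewrite -ball_normE /=.
  rewrite -addrA opprD addNKr normrN (le_lt_trans (ler_normD _ _))//.
  have dh : d = 3 * h by rewrite /h mulrC divfK.
  have A1 := norm_delta_mx a; have B1 := norm_delta_mx b.
  rewrite !normrZ (ger0_norm s0) (ger0_norm t0).
  have : s * `|e a : 'rV[R]_n| <= h * 1 by rewrite ler_pM.
  have : t * `|e b : 'rV[R]_n| <= h * 1 by rewrite ler_pM.
  by move=> ? ?; lra.
have [s [t [/andP[s0 sh] /andP[t0 th] E1]]] := @second_difference f x i j h h0
  (fun s t sh th => let y := (hd _ (ballP i j s t sh th)).1 in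
    conj (df _ y).1 (ddf _ y).1).
have [s' [t' [/andP[s'0 s'h] /andP[t'0 t'h] E2]]] := @second_difference f x j i h h0
  (fun s t sh th => let y := (hd _ (ballP j i s t sh th)).1 in
    conj (df _ y).2 (ddf _ y).2).
have [_ [A1 _]] : _ := hd (x + s *: e i + t *: e j) (ballP i j s t
  (introT andP (conj (ltW s0) (ltW sh))) (introT andP (conj (ltW t0) (ltW th)))).
have [_ [_ B1]] : _ := hd (x + s' *: e j + t' *: e i) (ballP j i s' t'
  (introT andP (conj (ltW s'0) (ltW s'h))) (introT andP (conj (ltW t'0) (ltW t'h)))).
have hN0 : h != 0 by rewrite gt_eqF.
have E3 : f (x + h *: e i + h *: e j) = f (x + h *: e j + h *: e i).
  by rewrite addrAC.
move: A1 B1 E1 E2; rewrite /= E3.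
set A := partial j _ (_ + _); set B := partial i _ (_ + _) => A1 B1 E1 E2.
set P := partial j (partial i f) x in A1 *.
set Q := partial i (partial j f) x in B1 *.
clearbody A B P Q.
have : h * (h * A) = h * (h * B) by rewrite -E1 -E2; ring.
move=> /(mulfI hN0)/(mulfI hN0) AB; rewrite AB {E1 E2} in A1.
move: A1 B1; rewrite /= !ltr_norml ler_norml => /andP[? ?] /andP[? ?].
by apply/andP; split; lra.
Qed.

Lemma eq_partial D f g i : open D -> {in D, f =1 g} -> {in D, partial i f =1 partial i g}.
Proof.
move=> oD fg x Dx; apply: near_eq_derive.
have : nbhs x D by apply: open_nbhs_nbhs; split => //; exact/set_mem.
by apply: filterS => y Dy; apply: fg; exact/mem_set.
Qed.

Lemma partials_perm D m f s t : open D -> continuously_differentiable m D f ->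
  (size s <= m)%N -> perm_eq s t -> {in D, partials s f =1 partials t f}.
Proof.
move=> oD cf; elim: s t => [t _|i s IH t sm].
  by rewrite perm_sym => /perm_nilP ->.
move=> st; have it : i \in t by rewrite -(perm_mem st) mem_head.
case/splitPr: it st => t1 t2 st0.
have st : perm_eq s (t1 ++ t2).
  by rewrite -(perm_cons i); apply: perm_trans st0 _; rewrite -[i :: t2]cat1s perm_catCA.
have sz : size s = size (t1 ++ t2) by exact: perm_size.
have h1 : {in D, partials (i :: s) f =1 partials (i :: (t1 ++ t2)) f}.
  by apply: eq_partial => //; apply: IH => //; exact: ltnW.
(* It remains to carry the letter [i] through [t1], which is done by exchanging it with one letter
   at a time. *)
suff h2 : {in D, partials (i :: (t1 ++ t2)) f =1 partials (t1 ++ i :: t2) f}.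
  by move=> x Dx; rewrite h1// h2.
move: sm; rewrite /= sz; elim: t1 {st0 st sz h1} => //= j t1 IHt sm.
have IH2 := eq_partial j oD (IHt (ltnW sm)).
move=> x Dx; rewrite -(IH2 x Dx) /=.
have szt : (size (t1 ++ t2) < m)%N by rewrite ltnW.
apply: (@partial_comm D _ j i x oD (set_mem Dx)).
- by move=> y Dy; have [_ /(_ szt) d] := cf _ (ltnW szt); split; exact: d.
- move=> y Dy; have [_ /(_ sm) d] := cf (j :: (t1 ++ t2)) (ltnW sm).
  by have [_ /(_ sm) d'] := cf (i :: (t1 ++ t2)) (ltnW sm); split; [exact: d|exact: d'].
- by have [c _] := cf (i :: j :: (t1 ++ t2)) sm; exact: c (set_mem Dx).
- by have [c _] := cf (j :: i :: (t1 ++ t2)) sm; exact: c (set_mem Dx).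
Qed.

End schwarz.

Lemma near_eq_continuous (T U : topologicalType) (f g : T -> U) (x : T) :
  (\near x, f x = g x) -> {for x, continuous f} -> {for x, continuous g}.
Proof.
move=> fg cf; rewrite /prop_for /continuous_at -(nbhs_singleton fg).
by apply: cvg_trans cf; exact: near_eq_cvg.
Qed.

(** * Integration by parts for C^1 functions *)

Section integration_by_parts.
Context {R : realType} (n : nat).
Implicit Types (D S : set 'rV[R]_n) (f g eta P : 'rV[R]_n -> R) (i : 'I_n).

Lemma integral_derivative0 (F f : R -> R) (a b : R) : a < b ->
  (forall t, is_derive t (1 : R) F (f t)) -> continuous f -> F a = 0 -> F b = 0 ->
  (\int[lebesgue_measure]_(t in `[a, b]) (f t)%:E = 0)%E.
Proof.
move=> ab dF cf Fa Fb.
have cF : continuous F.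
  move=> t; apply: differentiable_continuous; apply/derivable1_diffP.
  exact: (@ex_derive _ _ _ _ _ _ _ (dF t)).
rewrite (@continuous_FTC2 _ f F a b ab).
- by rewrite Fa Fb subee.
- exact: continuous_subspaceT.
- split; last 2 first.
  + exact: cvg_at_right_filter (cF a).
  + exact: cvg_at_left_filter (cF b).
  by move=> t _; exact: (@ex_derive _ _ _ _ _ _ _ (dF t)).
- by move=> t _; rewrite derive1E (@derive_val _ _ _ _ _ _ _ (dF t)).
Qed.

Lemma rV_updE i (x : 'rV[R]_n) (t : R) :
  rV_upd i x t = rV_upd i x 0 + t *: delta_mx ord0 i.
Proof.
apply/rowP => j; rewrite !mxE eqxx /=; case: (j == i).
  by rewrite mulr1 add0r.
by rewrite mulr0 addr0.
Qed.

Lemma rV_upd_norm i (x : 'rV[R]_n) (t : R) : `|t| <= `|rV_upd i x t|.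
Proof. by have := norm_rV_coord (rV_upd i x t) i; rewrite mxE eqxx. Qed.

Lemma is_derive_upd i f (x : 'rV[R]_n) (t df : R) :
  is_derive (rV_upd i x t) (delta_mx ord0 i) f df ->
  is_derive t (1 : R) (fun s => f (rV_upd i x s)) df.
Proof.
rewrite rV_updE => -[df1 <-].
rewrite (_ : (fun s => _) = (fun s => f (rV_upd i x 0 + s *: delta_mx ord0 i))).
  exact: is_derive_line.
by apply/funext => s; rewrite rV_updE.
Qed.

Lemma continuous_upd i (x : 'rV[R]_n) : continuous (rV_upd i x).
Proof.
move=> t; rewrite (_ : rV_upd i x = (fun s => rV_upd i x 0 + s *: delta_mx ord0 i)).
  apply: cvgD; first exact: cvg_cst.
  exact: scalel_continuous.
by apply/funext => s; rewrite rV_updE.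
Qed.

(** The product of [f] and [eta], set to 0 outside [D], has a continuous derivative in the direction
    [i] on the whole space: the support of [eta] is closed and contained in [D], so that a point
    outside [D] has a neighbourhood where the product vanishes. That derivative is the integrand,
    and its integral over a segment reaching beyond the support is 0. *)
Lemma integral_by_parts_C1 D i f : open D ->
  (forall x, D x -> {for x, continuous f}) ->
  (forall x, D x -> derivable f x (delta_mx ord0 i)) ->
  (forall x, D x -> {for x, continuous (partial i f)}) ->
  integral_by_parts D i f (partial i f).
Proof.
move=> oD cf df cpf; apply: integral_by_parts_lines => //.
- exact: continuous_loc_bounded.
- exact: continuous_loc_bounded.
move=> eta teta x.
have ceta := test_function_cont teta.
have cpeta := test_function_cont (test_function_partial i teta).
have deta y : derivable eta y (delta_mx ord0 i) by exact: test_function_derivable teta.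
have [_ [cse seD]] := teta.
pose w := (fun y => f y * eta y) \_ D.
pose G y := ((fun y => f y * partial i eta y) \_ D) y +
  ((fun y => partial i f y * eta y) \_ D) y.
have nearD y : D y -> \forall z \near y, D z by move=> Dy; exact: open_nbhs_nbhs.
have GE y : D y -> G y = f y * partial i eta y + partial i f y * eta y.
  by move=> Dy; rewrite /G !patchE mem_set.
have G0 y : ~ support eta y -> G y = 0.
  move=> sy; rewrite /G !patchE (partial_off_support _ sy) (support_sub sy) !mulr0.
  by case: ifP; rewrite addr0.
have wE y : D y -> w y = f y * eta y by move=> Dy; rewrite /w patchE mem_set.
have w0 y : ~ support eta y -> w y = 0.
  by move=> sy; rewrite /w patchE (support_sub sy) mulr0; case: ifP.
have nsupp y : ~ support eta y -> \forall z \near y, ~ support eta z.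
  move=> sy; apply: (@open_nbhs_nbhs _ y (~` support eta)); split => //.
  by apply: closed_openC; exact: closed_closure.
have dw y : is_derive y (delta_mx ord0 i) w (G y).
  have [Dy|/(contra_not (seD y)) sy] := pselect (D y).
    rewrite (GE _ Dy).
    apply: (@near_eq_is_derive _ _ _ (fun y => f y * eta y)).
      by near=> z; rewrite wE//; near: z; exact: nearD.
    by apply: is_deriveM_dir; apply: derivableP; [exact: df|exact: deta].
  rewrite (G0 _ sy); apply: (@near_eq_is_derive _ _ _ (cst 0)).
    by near=> z; rewrite w0//; near: z; exact: nsupp.
have cG : continuous G.
  move=> y; have [Dy|/(contra_not (seD y)) sy] := pselect (D y).
    apply: (@near_eq_continuous _ _ (fun y => f y * partial i eta y + partial i f y * eta y)).
      by near=> z; rewrite GE//; near: z; exact: nearD.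
    by apply: continuousD; apply: continuousM; [exact: cf|exact: cpeta|exact: cpf|exact: ceta].
  have : {for y, continuous (cst (0 : R))} by exact: cst_continuous.
  apply: near_eq_continuous.
  by near=> z; rewrite G0//; near: z; exact: nsupp.
have [B B0 eB] := rV_compact_box cse.
have out t : B < `|t| -> ~ support eta (rV_upd i x t).
  move=> Bt /eB; apply/negP; rewrite -ltNge (lt_le_trans Bt)//.
  exact: rV_upd_norm.
pose b := B + 1.
have I0 : (\int[lebesgue_measure]_(t in `[(- b)%R, b]) (G (rV_upd i x t))%:E = 0)%E.
  apply: (@integral_derivative0 (fun t => w (rV_upd i x t))).
  - by rewrite /b; lra.
  - by move=> t; apply: is_derive_upd.
  - by move=> t; apply: continuous_comp; [exact: continuous_upd|exact: cG].
  - by apply/w0/out; rewrite normrN ger0_norm /b; lra.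
  - by apply/w0/out; rewrite ger0_norm /b; lra.
apply: etrans _ I0; rewrite [RHS]integral_mkcond; apply: eq_integral => t _.
rewrite -/(G _) patchE; case: ifPn => [//|tb].
rewrite G0//; apply: out; move: tb; rewrite notin_setE /= in_itv /= -ler_norml.
by move=> /negP; rewrite -ltNge /b; lra.
Unshelve. all: by end_near. Qed.

End integration_by_parts.

(** * Weak derivatives of truncated functions and of higher order *)

Section weak_derivatives.
Context {R : realType} (n : nat).
Implicit Types (D S : set 'rV[R]_n) (f g eta P : 'rV[R]_n -> R) (i : 'I_n).

Lemma loc_bounded_patch D S P : open S -> continuous P -> loc_bounded D (P \_ S).
Proof.
move=> oS cP; split.
  apply: measurable_funTS; apply/(measurable_restrictT _ _).1.
    exact: rV_open_measurable.
  by apply: measurable_funTS; apply: rV_continuous_measurable; [exact: openT|move=> x _; exact: cP].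
have [_ bP] : loc_bounded setT P by apply: continuous_loc_bounded; [exact: openT|move=> x _; exact: cP].
move=> K cK _; have [M PM] := bP K cK (@subsetT _ _); exists `|M| => x Kx.
rewrite patchE; case: ifPn => _; last by rewrite normr0.
by rewrite (le_trans (PM x Kx))// ler_norm.
Qed.

(* No boundary term appears: every line parallel to the i-th axis meets S in an
   interval at whose ends P vanishes. *)
Lemma integral_by_parts_cut D S i P : open D -> open S -> S `<=` D ->
  continuous P -> (forall x, derivable P x (delta_mx ord0 i)) ->
  continuous (partial i P) ->
  (forall x, exists l r : R, (forall t, S (rV_upd i x t) <-> l < t < r) /\
     (l < r -> P (rV_upd i x l) = 0 /\ P (rV_upd i x r) = 0)) ->
  integral_by_parts D i (P \_ S) (partial i P \_ S).
Proof.
move=> oD oS SD cP dP cpP lineS; apply: integral_by_parts_lines => //.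
- exact: loc_bounded_patch.
- exact: loc_bounded_patch.
move=> eta teta x.
have ceta := test_function_cont teta.
have cpeta := test_function_cont (test_function_partial i teta).
have deta y : derivable eta y (delta_mx ord0 i) by exact: test_function_derivable teta.
pose w y := P y * eta y.
pose G y := P y * partial i eta y + partial i P y * eta y.
have dw y : is_derive y (delta_mx ord0 i) w (G y).
  exact: (is_deriveM_dir (derivableP (dP y)) (derivableP (deta y))).
have cG : continuous G.
  move=> y; have c1 : {for y, continuous (fun y => P y * partial i eta y)}.
    by apply: continuousM; [exact: cP|exact: cpeta].
  have c2 : {for y, continuous (fun y => partial i P y * eta y)}.
    by apply: continuousM; [exact: cpP|exact: ceta].
  exact: (continuousD c1 c2).
have cGl : continuous (fun t => G (rV_upd i x t)).
  by move=> t; apply: continuous_comp; [exact: continuous_upd|exact: cG].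
have [l [r [Slr P0]]] := lineS x.
have E t : ((fun y => (P \_ S) y * partial i eta y) \_ D) (rV_upd i x t) +
    ((fun y => (partial i P \_ S) y * eta y) \_ D) (rV_upd i x t) =
    ((fun t => G (rV_upd i x t)) \_ `]l, r[) t.
  rewrite !patchE.
  have -> : (t \in `]l, r[%classic) = (rV_upd i x t \in S).
    by apply/idP/idP => /set_mem; [rewrite /= in_itv /= => /Slr|move=> /Slr h] => *;
      apply/mem_set => //=; rewrite in_itv.
  have [Sx|nSx] := pselect (S (rV_upd i x t)).
    by rewrite (mem_set Sx) (mem_set (SD _ Sx)).
  by rewrite (memNset nSx) !mul0r; case: ifP; rewrite addr0.
transitivity (\int[lebesgue_measure]_(t in `]l, r[) (G (rV_upd i x t))%:E)%E.
  rewrite [RHS]integral_mkcond; apply: eq_integral => t _.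
  by rewrite E !patchE; case: ifPn.
have [rl|lr] := leP r l.
  by rewrite set_itv_ge ?integral_set0// bnd_simp -leNgt.
have [Pl Pr] := P0 lr.
have mG b0 b1 : measurable_fun [set` Interval (BSide b0 l) (BSide b1 r)] (fun t => (G (rV_upd i x t))%:E).
  apply/measurable_EFinP; apply: measurable_funTS.
  exact: continuous_measurable_fun.
rewrite -(@integral_itv_bndoo _ _ _ _ true false)//.
apply: (@integral_derivative0 _ (fun t => w (rV_upd i x t))) => //.
- by move=> t; apply: is_derive_upd.
- by rewrite /w Pl mul0r.
- by rewrite /w Pr mul0r.
Qed.

(** The head of the word is the outermost derivative of [eta], hence the first to be moved, and it
    lands below the ones that follow. The word therefore arrives reversed, which is what [catrev]
    records. *)
Lemma integral_by_parts_iter D k (F : seq 'I_n -> 'rV[R]_n -> R) :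
  (forall s i, (size s < k)%N -> integral_by_parts D i (F s) (F (i :: s))) ->
  forall s r eta, test_function D eta -> (size r + size s <= k)%N ->
  \int[rV_lebesgue R n]_(x in D) (F r x * partials s eta x) =
  (-1) ^+ size s * \int[rV_lebesgue R n]_(x in D) (F (catrev s r) x * eta x).
Proof.
move=> ibp; elim => [r eta teta _|i s IH r eta teta sz] /=.
  by rewrite expr0 mul1r.
rewrite /= addnS in sz.
rewrite ibp//; last 2 first.
- by rewrite (leq_trans _ sz)// ltnS leq_addr.
- exact: test_function_partials.
by rewrite IH// exprS -mulrA mulN1r.
Qed.

Lemma weak_partial_eq D s f g g' : {in D, g =1 g'} ->
  weak_partial D s f g -> weak_partial D s f g'.
Proof.
move=> gg' [lf lg ibp]; split => //.
  move=> K cK KD; apply: eq_integrable (lg K cK KD); first exact: rV_compact_measurable.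
  by move=> x /set_mem Kx /=; rewrite gg'//; apply/mem_set/KD.
move=> eta teta; rewrite ibp//; congr (_ * _).
by apply: eq_Rintegral => x Dx; rewrite gg'.
Qed.

(** Invariance under permutation undoes the reversal and gives access to the sorted word, by which
    [jet_of] represents all rearrangements. *)
Lemma weak_partial_family D k (F : seq 'I_n -> 'rV[R]_n -> R) : open D ->
  (forall s, (size s <= k)%N -> loc_bounded D (F s)) ->
  (forall s i, (size s < k)%N -> integral_by_parts D i (F s) (F (i :: s))) ->
  (forall s t, (size s <= k)%N -> perm_eq s t -> {in D, F s =1 F t}) ->
  forall s t, (size s <= k)%N -> perm_eq s t -> weak_partial D s (F [::]) (F t).
Proof.
move=> oD bF ibp permF s t sk st.
apply: (@weak_partial_eq _ _ _ (F (rev s))).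
  by apply: permF; rewrite ?size_rev// perm_rev.
split.
- by apply: loc_bounded_integrable => //; exact: bF.
- by apply: loc_bounded_integrable => //; apply: bF; rewrite size_rev.
- by move=> eta teta; rewrite (integral_by_parts_iter ibp).
Qed.

(** Provides the weak jet of u + t phi; local boundedness makes each integral finite, so that the
    sums can be split. *)
Lemma weak_partial_lin D s (c : R) f1 f2 g1 g2 : open D ->
  loc_bounded D f1 -> loc_bounded D f2 -> loc_bounded D g1 -> loc_bounded D g2 ->
  weak_partial D s f1 g1 -> weak_partial D s f2 g2 ->
  weak_partial D s (fun x => f1 x + c * f2 x) (fun x => g1 x + c * g2 x).
Proof.
move=> oD bf1 bf2 bg1 bg2 [_ _ w1] [_ _ w2]; split.
- apply: loc_bounded_integrable => //; apply: loc_boundedD => //.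
  exact: loc_boundedZ.
- apply: loc_bounded_integrable => //; apply: loc_boundedD => //.
  exact: loc_boundedZ.
move=> eta teta; have mD := rV_open_measurable oD.
have ts := test_function_partials s teta.
have I h zeta : loc_bounded D h -> test_function D zeta ->
    (rV_lebesgue R n).-integrable D (EFin \o (fun x => h x * zeta x)).
  move=> bh tz; apply: loc_bounded_mul_integrable => //; first exact: tz.2.
  exact: test_function_cont tz.
have L h1 h2 zeta : loc_bounded D h1 -> loc_bounded D h2 -> test_function D zeta ->
    \int[rV_lebesgue R n]_(x in D) ((h1 x + c * h2 x) * zeta x) =
    \int[rV_lebesgue R n]_(x in D) (h1 x * zeta x) +
    c * \int[rV_lebesgue R n]_(x in D) (h2 x * zeta x).
  move=> b1 b2 tz.
  have I1 := I _ _ b1 tz; have I2 := I _ _ b2 tz.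
  have I3 : (rV_lebesgue R n).-integrable D (EFin \o (fun x => c * (h2 x * zeta x))).
    exact: eq_integrable (integrableZl mD c I2).
  rewrite -(RintegralZl c mD I2) -(RintegralD mD I1 I3).
  by apply: eq_Rintegral => x _; rewrite mulrDl mulrA.
by rewrite !L// w1// w2// mulrDr mulrCA.
Qed.

End weak_derivatives.

(** * Differentiability of functions with continuous partial derivatives *)

Section C1_differentiable.
Context {R : realType} (n : nat).
Implicit Types (D : set 'rV[R]_n) (f : 'rV[R]_n -> R) (i j : 'I_n).
Local Notation e i := (delta_mx ord0 i : 'rV[R]_n).

Lemma MVT_line_signed f (x v : 'rV[R]_n) (h : R) :
  (forall t, `|t| <= `|h| -> derivable f (x + t *: v) v) ->
  exists2 c, `|c| <= `|h| & f (x + h *: v) - f x = h * 'D_v f (x + c *: v).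
Proof.
move=> df; have [h0|h0|->] := ltgtP h 0; last first.
- by exists 0; rewrite ?normr0// scale0r addr0 subrr mul0r.
- have [|c /andP[c0 ch] ->] := @MVT_line _ _ f x v h h0.
    by move=> t /andP[t0 th]; apply: df; rewrite !ger0_norm// ltW.
  by exists c => //; rewrite !ger0_norm// ltW.
have nh0 : 0 < - h by rewrite oppr_gt0.
have [|c /andP[c0 ch] E] := @MVT_line _ _ f (x + h *: v) v (- h) nh0.
  move=> t /andP[t0 th]; rewrite -addrA -scalerDl; apply: df.
  by rewrite (ltr0_norm h0) ler_norml; apply/andP; split; lra.
exists (h + c); first by rewrite (ltr0_norm h0) ler_norml; apply/andP; split; lra.
move: E; rewrite -!addrA -!scalerDl subrr scale0r addr0 => E.
by rewrite -opprB E mulNr opprK.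
Qed.

Lemma taylor_partials f x (p : 'I_n -> R) (d eps : R) h :
  (forall y i, `|y - x| <= d -> derivable f y (e i)) ->
  (forall y i, `|y - x| <= d -> `|partial i f y - p i| <= eps) ->
  `|h| <= d ->
  `|f (x + h) - f x - \sum_i h ord0 i * p i| <= n%:R * (eps * `|h|).
Proof.
move=> df dp hd.
have d0 : 0 <= d by apply: le_trans hd.
(* The path from [x] to [x + h] changes one coordinate at a time, and each of the [n] moves costs an
   error of at most [eps * |h|]. It stays in the ball because the norm is the maximum norm. *)
pose tr m : 'rV[R]_n := \row_j if (j < m)%N then h ord0 j else 0.
have trh m : `|tr m| <= `|h|.
  rewrite norm_rV_le//; apply/forallP => j; rewrite mxE; case: ifP => _.
    exact: norm_rV_coord.
  by rewrite normr0.
suff H m : (m <= n)%N -> `|f (x + tr m) - f x - \sum_(i < n | (i < m)%N) h ord0 i * p i|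
    <= m%:R * (eps * `|h|).
  have := H n (leqnn n).
  have -> : tr n = h by apply/rowP => j; rewrite mxE ltn_ord.
  by congr (`|_ - _| <= _); apply: eq_bigl => i; rewrite ltn_ord.
elim: m => [_|m IH mn].
  have -> : tr 0%N = 0 by apply/rowP => j; rewrite !mxE.
  by rewrite addr0 subrr sub0r mul0r big_pred0// oppr0 normr0.
pose im := Ordinal mn.
have trS : tr m.+1 = tr m + h ord0 im *: e im.
  apply/rowP => j; rewrite !mxE eqxx /= ltnS leq_eqVlt.
  have -> : (j == im) = (j == m :> nat) by [].
  have [jm|jm] := eqVneq (j : nat) m; last by rewrite mulr0 addr0.
  by rewrite jm ltnn add0r mulr1; congr (h _ _); exact: val_inj.
have hm : `|h ord0 im| <= `|h| by exact: norm_rV_coord.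
have inball t : `|t| <= `|h ord0 im| -> `|x + tr m + t *: e im - x| <= d.
  move=> th; rewrite -[x + _ + _]addrA [x + _]addrC addrK (le_trans _ hd)//.
  rewrite norm_rV_le//; apply/forallP => j; rewrite !mxE eqxx /=.
  case: ltnP => jm.
    rewrite (_ : j == im = false) ?mulr0 ?addr0; first exact: norm_rV_coord.
    by apply/negbTE; apply: contraTneq jm => ->; rewrite -leqNgt.
  rewrite add0r; case: (j == im); rewrite ?mulr0 ?normr0// mulr1.
  exact: le_trans hm.
have [|c ch E] := @MVT_line_signed f (x + tr m) (e im) (h ord0 im).
  by move=> t th; apply: df; exact: inball.
have bd := dp _ im (inball c ch).
rewrite (bigD1 im) /= ?ltnSn//.
rewrite (eq_bigl (fun i : 'I_n => (i < m)%N)); last first.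
  move=> i; rewrite ltnS leq_eqVlt (_ : (i != im) = (i != m :> nat))//.
  by case: eqVneq => [->|]; rewrite ?ltnn// andbT.
have IHm := IH (ltnW mn).
rewrite trS addrA.
have -> : f (x + tr m + h ord0 im *: e im) - f x - (h ord0 im * p im +
    \sum_(i < n | (i < m)%N) h ord0 i * p i) =
  (f (x + tr m) - f x - \sum_(i < n | (i < m)%N) h ord0 i * p i) +
  h ord0 im * ('D_(e im) f (x + tr m + c *: e im) - p im).
  by rewrite mulrBr -E; ring.
rewrite -natr1 mulrDl mul1r (le_trans (ler_normD _ _))// lerD//.
by rewrite normrM mulrC ler_pM.
Qed.

(** The hypothesis says that [g] has differential 0 at [x]; [C1_differentiable] reduces to this case
    by subtracting the candidate linear part. *)
Lemma differentiable_small (V W : normedModType R) (g : V -> W) x :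
  (forall eps : R, 0 < eps -> \forall h \near 0, `|g (h + x) - g x| <= eps * `|h|) ->
  differentiable g x.
Proof.
move=> H; have E : g \o shift x = cst (g x) + (\0 : V -> W) +o_ 0 id.
  apply/eqaddoP => eps eps0; have := H _ eps0.
  by apply: filterS => h; rewrite !fctE /= addr0.
have dz : continuous (\0 : V -> W) by move=> y; exact: cst_continuous.
apply/diff_locallyP; rewrite (diff_unique dz E); split => //.
Qed.

Lemma C1_differentiable D f x : open D -> D x ->
  (forall y i, D y -> derivable f y (e i)) ->
  (forall i, {for x, continuous (partial i f)}) ->
  differentiable f x.
Proof.
move=> oD Dx df cf.
pose L := \sum_(i < n) (fun y : 'rV[R]_n => partial i f x *: (y ord0 i : R)).
have dL : differentiable L x.
  apply: differentiable_sum => i.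
  exact: (@differentiableZ _ _ _ (fun y : 'rV[R]_n => y ord0 i) _ _ (differentiable_coord _ _ _)).
suff dg : differentiable (f \- L) x.
  rewrite (_ : f = (f \- L) + L); first exact: differentiableD.
  by apply/funext => y; rewrite !fctE /= subrK.
apply: differentiable_small => eps eps0.
(* [taylor_partials] loses a factor [n]; the added 1 keeps the divisor positive in every
   dimension. *)
pose eps' := eps / (n%:R + 1).
have eps'0 : 0 < eps' by rewrite divr_gt0// ltr_wpDl.
have /nbhs_ballP[d /= d0 hd] : nbhs x (D `&` [set y | forall i, `|partial i f x - partial i f y| < eps']).
  apply: filterI; first exact: open_nbhs_nbhs.
  have c i : \forall y \near x, `|partial i f x - partial i f y| < eps'.
    by move/cvgr_dist_lt: (cf i); exact.
  exact: (filter_forall (nbhs_filter x) c).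
have inb y : `|y - x| <= d / 2 -> ball x d y.
  move=> yx; rewrite -ball_normE /= distrC (le_lt_trans yx)//.
  by rewrite ltr_pdivrMr// ltr_pMr// ltr1n.
have d20 : 0 < d / 2 by rewrite divr_gt0.
near=> h.
have hd2 : `|h| <= d / 2.
  near: h; exact: (@nbhs0_le R 'rV[R]_n _ d20).
have LE y : L y = \sum_i y ord0 i * partial i f x.
  by rewrite /L fct_sumE; apply: eq_bigr => i _; rewrite [LHS]mulrC.
rewrite [X in `|X|](_ : _ = f (x + h) - f x - \sum_i h ord0 i * partial i f x); last first.
  have -> : (f \- L) (h + x) - (f \- L) x = f (h + x) - L (h + x) - (f x - L x) by [].
  rewrite !LE [h + x]addrC.
  have -> : \sum_i (x + h) ord0 i * partial i f x =
      \sum_i x ord0 i * partial i f x + \sum_i h ord0 i * partial i f x.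
    by rewrite -big_split; apply: eq_bigr => i _; rewrite mxE mulrDl.
  ring.
apply: (@le_trans _ _ (n%:R * (eps' * `|h|))).
  apply: (@taylor_partials f x (fun i => partial i f x) (d / 2) eps' h _ _ hd2).
  - by move=> y i /inb/hd[Dy _]; exact: df.
  - by move=> y i /inb/hd[_ /(_ i)/ltW]; rewrite distrC.
rewrite mulrA ler_wpM2r// /eps' mulrA ler_pdivrMr ?ltr_wpDl// mulrC ler_wpM2l ?(ltW eps0)//.
by rewrite lerDl.
Unshelve. all: by end_near. Qed.

End C1_differentiable.

(** * Bases of the space of jets *)

Section continuous_big.
Context {R : realType} (T : topologicalType) (I : Type).
Implicit Types (r : seq I) (p : T).

Lemma continuous_sum (V : normedModType R) r (F : I -> T -> V) p :
  (forall i, {for p, continuous (F i)}) ->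
  {for p, continuous (fun q => \sum_(i <- r) F i q)}.
Proof.
move=> cF; elim: r => [|i r IH].
  rewrite (_ : (fun _ => _) = cst 0); first exact: cst_continuous.
  by apply/funext => q; rewrite big_nil.
rewrite (_ : (fun _ => _) = F i + (fun q => \sum_(i <- r) F i q)).
  exact: (continuousD (cF i) IH).
by apply/funext => q; rewrite big_cons.
Qed.

End continuous_big.

Section jet_basis.
Context {R : realType} (n k : nat).
Implicit Types (X : jet R n k) (s t : k.-bseq 'I_n).

(** The resulting jets span but are indexed redundantly: words that are permutations of each other
    give the same jet, and division by their number compensates for the repetition in
    [jet_basisE]. *)
Lemma jet_basis_subproof s :
  [ffun t : k.-bseq 'I_n => (perm_eq s t)%:R / #|[pred r : k.-bseq 'I_n | perm_eq s r]|%:R]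
    \in symmetric_words R n k.
Proof.
apply/symmetric_wordsP => t r tr; rewrite !ffunE.
by have -> : perm_eq s t = perm_eq s r by exact/(permPr tr).
Qed.

Definition jet_basis s : jet R n k := Jet (jet_basis_subproof s).

Lemma jet_basisE X : X = \sum_s X s *: jet_basis s.
Proof.
apply/val_inj/ffunP => t; rewrite raddf_sum /= sum_ffunE.
under eq_bigr => s _ do rewrite !ffunE /GRing.scale /=.
pose c : R := #|[pred r : k.-bseq 'I_n | perm_eq t r]|%:R.
have c0 : c != 0.
  by rewrite pnatr_eq0 -lt0n; apply/card_gt0P; exists t; rewrite inE.
rewrite (bigID (fun s : k.-bseq 'I_n => perm_eq t s)) /= [X in _ + X]big1 ?addr0; last first.
  by move=> s /negbTE ts; rewrite perm_sym ts mul0r mulr0.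
rewrite (eq_bigr (fun=> X t / c)).
  by rewrite sumr_const -[#|_|]/(#|[pred r : k.-bseq 'I_n | perm_eq t r]|) -[X in X *+ _]/(_ / _) -mulr_natr -/c divfK.
move=> s ts; rewrite perm_sym ts mul1r.
have /symmetric_wordsP XE := jet_symmetric X.
rewrite (XE _ _ ts); congr (_ / _%:R).
apply: eq_card => r; rewrite !inE.
by apply/idP/idP => h; apply: perm_trans h; rewrite // perm_sym.
Qed.

Lemma jet_continuous (T : topologicalType) (Y : T -> jet R n k) p :
  (forall s, {for p, continuous (fun q => Y q s)}) -> {for p, continuous Y}.
Proof.
move=> cY; rewrite (_ : Y = fun q => \sum_s Y q s *: jet_basis s); last first.
  by apply/funext => q; exact: jet_basisE.
apply: continuous_sum => s.
by apply: continuousZ; [exact: cY|exact: cst_continuous].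
Qed.

Lemma jet_differentiable (V : normedModType R) (Y : V -> jet R n k) p :
  (forall s, differentiable (fun q => Y q s) p) -> differentiable Y p.
Proof.
move=> dY.
rewrite (_ : Y = \sum_(s : k.-bseq 'I_n) (fun q => Y q s *: jet_basis s)); last first.
  by apply/funext => q; rewrite fct_sumE; exact: jet_basisE.
have dsum r : differentiable (\sum_(s <- r) (fun q => Y q s *: jet_basis s)) p.
  elim: r => [|s r IH]; first by rewrite big_nil; exact: differentiable_cst.
  rewrite big_cons; apply: differentiableD IH.
  exact: (@differentiableZl _ _ _ (fun q => Y q s)).
exact: dsum.
Qed.

Section directional.
Variables (Omega : set 'rV[R]_n) (H : 'rV[R]_n * jet R n k -> R).
Hypothesis hH : C1_on_jets Omega H.

Lemma diff_jetE p X : Omega p.1 ->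
  'd H p (0, X) = \sum_s X s * 'd H p (0, jet_basis s).
Proof.
move=> Op; rewrite [in LHS](jet_basisE X).
have L (r : seq (k.-bseq 'I_n)) : 'd H p (0, \sum_(s <- r) X s *: jet_basis s) =
    \sum_(s <- r) X s * 'd H p (0, jet_basis s).
  elim: r => [|s r IH].
    by rewrite !big_nil -[(0, 0)]/(0 : 'rV[R]_n * jet R n k) linear0.
  rewrite !big_cons -IH -[X s * _]/(X s *: _) -linearZ -linearD; congr ('d H p _).
  by congr pair; rewrite /= scaler0 addr0.
exact: L.
Qed.

(** [C1_on_jets] gives continuity of the differential in a fixed direction only. A direction that
    varies with the point is expanded in the finite family [jet_basis], with continuous
    coefficients. *)
Lemma diff_jet_continuous (T : topologicalType) (P : T -> 'rV[R]_n * jet R n k)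
    (Y : T -> jet R n k) p : (\near p, Omega (P p).1) ->
  {for p, continuous P} -> (forall s, {for p, continuous (fun q => Y q s)}) ->
  {for p, continuous (fun q => 'd H (P q) (0, Y q))}.
Proof.
move=> OP cP cY.
apply: (@near_eq_continuous _ _ (fun q => \sum_s Y q s * 'd H (P q) (0, jet_basis s))).
  by apply: filterS OP => q Oq; rewrite [RHS]diff_jetE.
apply: continuous_sum => s; apply: continuousM; first exact: cY.
have [_ /(_ (0, jet_basis s)) cd] := hH (nbhs_singleton OP).
by apply: (@continuous_comp _ _ _ P (fun q => 'd H q (0, jet_basis s))).
Qed.

End directional.

End jet_basis.

(** * Danskin's theorem *)

Section continuous_order.
Context {R : realType} (T : topologicalType).
Implicit Types (f : T -> R) (y : T) (z : R).

Lemma continuous_near_lt f y z : {for y, continuous f} -> f y < z ->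
  \forall x \near y, f x < z.
Proof. by move=> cf; apply: (@cvgr_lt R T (nbhs y) _ f (f y) cf). Qed.

Lemma continuous_near_gt f y z : {for y, continuous f} -> z < f y ->
  \forall x \near y, z < f x.
Proof. by move=> cf; apply: (@cvgr_gt R T (nbhs y) _ f (f y) cf). Qed.

End continuous_order.

Section danskin.
Context {R : realType} (T : topologicalType).
Variables (K : set T) (g dg : R -> T -> R) (m : R -> R).
Hypotheses (cK : compact K) (clK : closed K).
Hypothesis dgP : forall t y, K y -> is_derive t (1 : R) (g^~ y) (dg t y).
Hypothesis cg : forall y, K y -> {for y, continuous (g 0)}.
Hypothesis cdg : forall y, K y ->
  {for (0 : R, y), continuous (fun p : R * T => dg p.1 p.2)}.
Hypothesis m_ub : forall t y, K y -> g t y <= m t.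
Hypothesis m_max : forall t, exists2 y, K y & g t y = m t.

Let A := [set y | K y /\ g 0 y = m 0].

Lemma danskin_MVT t y : 0 < t -> K y ->
  exists2 c, 0 < c < t & g t y = g 0 y + t * dg c y.
Proof.
move=> t0 Ky; have [||c] := @MVT R (g^~ y) (dg^~ y) 0 t t0.
- by move=> s _; exact: dgP.
- apply: continuous_in_subspaceT => s _; apply: differentiable_continuous.
  by apply/derivable1_diffP; exact: (@ex_derive _ _ _ _ _ _ _ (dgP s Ky)).
rewrite in_itv /= subr0 => ct E; exists c => //.
by rewrite mulrC -E addrC subrK.
Qed.

Lemma compact_argmax : compact A.
Proof.
apply: subclosed_compact cK _; last by move=> y [].
rewrite -[A]setCK; apply: open_closedC; rewrite openE => y nA.
have [Ky|nK] := pselect (K y); last first.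
  have : nbhs y (~` K) by apply: open_nbhs_nbhs; split => //; exact: closed_openC.
  by apply: filterS => z nKz [].
have : g 0 y < m 0.
  rewrite lt_neqAle m_ub// andbT; apply/eqP => E; exact: nA.
move=> /(continuous_near_lt (cg Ky)).
by apply: filterS => z gz [_ E]; move: gz; rewrite E ltxx.
Qed.

(** The slope is the largest value of [dg 0] on the set [A] of maximum points of [g 0]. A point of
    [A] where it is attained bounds [m t] from below; from above, points near [A] grow at most at
    the rate [l + eps], and the others start too low to catch up for small t. *)
Lemma danskin : exists l, (exists2 y, A y & l = dg 0 y) /\
  (m t - m 0) / t @[t --> 0^'+] --> l.
Proof.
have A0 : A !=set0 by have [y Ky gy] := m_max 0; exists y.
have cdgA : {within A, continuous (dg 0)}.
  apply: continuous_in_subspaceT => y /set_mem [Ky _].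
  apply: (@continuous_comp _ _ _ (fun z => (0 : R, z)) (fun p : R * T => dg p.1 p.2)).
    exact: (cvg_pair (cvg_cst (0 : R)) cvg_id).
  exact: cdg.
have [y0 /set_mem Ay0 dgmax] := compact_EVT_max A0 compact_argmax cdgA.
have Ky0 := Ay0.1; have gy0 := Ay0.2.
exists (dg 0 y0); split; first by exists y0.
set l := dg 0 y0.
apply/cvgrPdist_le => eps eps0.
(* A product neighbourhood is needed because the mean value theorem evaluates [dg] at an unknown
   time between 0 and t. *)
have rect (y : T) (Q : R -> T -> Prop) : (\forall p \near (0 : R, y), Q p.1 p.2) ->
    exists2 d : R, 0 < d & \forall y' \near y, forall t, `|t| < d -> Q t y'.
  move=> [[U V] /= [/nbhs_ballP[d /= d0 dU] nV] UV].
  exists d => //; apply: filterS nV => z Vz t td; apply: (UV (t, z)); split => //=.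
  by apply: dU; rewrite -ball_normE /= sub0r normrN.
(* One range of t must serve all points of [K]. Compactness merges local bounds of two kinds,
   according to whether the point is in [A] or not. *)
have up : \forall t \near (0 : R), forall y, K y -> 0 < t -> g t y <= m 0 + t * (l + eps).
  suff : \forall t \near (0 : R), K `<=` (fun y => K y -> 0 < t -> g t y <= m 0 + t * (l + eps)).
    by apply: filterS => t H y Ky; exact: (H y Ky Ky).
  have /compact_near_coveringP ncK := cK.
  apply: (ncK R (nbhs (0 : R))
    (fun t y => K y -> 0 < t -> g t y <= m 0 + t * (l + eps))) => y Ky.
  have [gy|gy] := eqVneq (g 0 y) (m 0).
    have dgl : dg 0 y < l + eps.
      by rewrite (le_lt_trans (dgmax y _)) ?ltrDl//; apply/mem_set.
    have [d d0 near_y] := rect y (fun t z => dg t z < l + eps)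
      (continuous_near_lt (cdg Ky) dgl).
    have near_t := @nbhs0_lt R R d d0.
    exists ([set z | forall t, `|t| < d -> dg t z < l + eps], [set t | `|t| < d]) => //.
    move=> [z t] /= [hz ht] Kz t0.
    have [c /andP[c0 ct] ->] := danskin_MVT t0 Kz.
    rewrite lerD ?m_ub// ler_pM2l// ltW// hz//.
    by rewrite gtr0_norm// (lt_trans ct)// -(gtr0_norm t0).
  have gy' : g 0 y < m 0 by rewrite lt_neqAle gy m_ub.
  have dg1 : dg 0 y < dg 0 y + 1 by rewrite ltrDl.
  (* Near a point outside [A], [g 0] stays below [m 0] by [del]. The increment exceeds
     [t * (l + eps)] by at most [t * C], which is less than [del] as soon as [t < del / C]. *)
  pose del := (m 0 - g 0 y) / 2.
  have del0 : 0 < del by rewrite divr_gt0 ?subr_gt0.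
  pose C := `|dg 0 y + 1| + `|l + eps| + 1.
  have C0 : 0 < C by rewrite ltr_wpDl ?addr_ge0.
  have [d d0 near_y] := rect y (fun t z => dg t z < dg 0 y + 1)
      (continuous_near_lt (cdg Ky) dg1).
  have gd : g 0 y < m 0 - del by rewrite /del; lra.
  have near_g := continuous_near_lt (cg Ky) gd.
  have near_t := @nbhs0_lt R R d d0.
  have near_t' := @nbhs0_lt R R (del / C) (divr_gt0 del0 C0).
  exists ([set z | (forall t, `|t| < d -> dg t z < dg 0 y + 1) /\ g 0 z < m 0 - del],
          [set t | `|t| < d /\ `|t| < del / C]).
    by split; [exact: filterI|exact: filterI].
  move=> [z t] /= [[hz hg] [ht ht']] Kz t0.
  have [c /andP[c0 ct] ->] := danskin_MVT t0 Kz.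
  rewrite (gtr0_norm t0) in ht ht'.
  have dc : dg c z < dg 0 y + 1 by rewrite hz// gtr0_norm// (lt_trans ct).
  have tC : t * C < del by rewrite -ltr_pdivlMr.
  have : t * (dg c z - (l + eps)) <= t * C.
    rewrite ler_pM2l// /C.
    have := ler_norm (dg 0 y + 1); have := ler_norm (- (l + eps)).
    by rewrite normrN => *; lra.
  by rewrite mulrBr => ?; lra.
have l_eps : l - eps < l by rewrite ltrBlDr ltrDl.
have [d d0 near_0] := rect y0 (fun t z => l - eps < dg t z)
   (continuous_near_gt (cdg Ky0) l_eps).
have lowd := nbhs_singleton near_0.
near=> t.
have t0 : 0 < t by near: t; exact: nbhs_right_gt.
have td : t < d by near: t; exact: nbhs_right_lt.
have upt : forall y, K y -> 0 < t -> g t y <= m 0 + t * (l + eps).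
  by near: t; exact: cvg_within.
have [y Ky gy] := m_max t.
have u := upt y Ky t0; rewrite gy in u.
(* The lower bound needs only the competitor [y0], since [m t] is at least [g t y0]. *)
have [c /andP[c0 ct] E] := danskin_MVT t0 Ky0.
have lo : l - eps < dg c y0 by apply: lowd; rewrite gtr0_norm// (lt_trans ct).
have lo' := m_ub t Ky0; rewrite E gy0 in lo'.
have lo2 : t * (l - eps) <= t * dg c y0 by rewrite ler_pM2l// ltW.
rewrite ler_distlC; apply/andP; split.
  by rewrite ler_pdivlMr// mulrC; lra.
by rewrite ler_pdivrMr// mulrC; lra.
Unshelve. all: by end_near. Qed.

End danskin.

(** * The essential supremum of a continuous function *)

Section essential_supremum.
Context {R : realType} (n : nat).

(** The maximum of [g] may be attained only on the boundary of [O]. By continuity and density, [g]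
    still exceeds any [c < m] on a non-empty open subset of [O], and such a set has positive
    measure. *)
Lemma ess_sup_on_max (O K : set 'rV[R]_n) (f g : 'rV[R]_n -> R) (m : R) :
  open O -> O `<=` K -> K `<=` closure O ->
  (forall y, O y -> f y = g y) ->
  (forall y, K y -> {for y, continuous g}) ->
  (forall y, K y -> g y <= m) -> (exists2 y, K y & g y = m) ->
  ess_sup_on O f = m%:E.
Proof.
move=> oO OK KO fg cg gm [y Ky gy]; apply/eqP; rewrite eq_le; apply/andP; split.
  apply/ess_supP; apply: nearW => x; case: ifPn => [/set_mem Ox|_]; last exact: leNye.
  by rewrite lee_fin fg// gm//; exact: OK.
rewrite leNgt; apply/negP => lt_m.
(* A priori the essential supremum could be -oo; then [m - 1] serves as the real level. *)
have [c [cm Ec]] : exists c : R, c < m /\ (ess_sup_on O f <= c%:E)%E.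
  move: lt_m; case: (ess_sup_on O f) => [r|//|_].
    by rewrite lte_fin => rm; exists r.
  by exists (m - 1); split; [rewrite ltrBlDr ltrDl|exact: leNye].
pose U := O `&` [set x | c < g x].
have oU : open U.
  rewrite openE => x [Ox cx]; apply: filterI; first exact: open_nbhs_nbhs.
  exact: (continuous_near_gt (cg x (OK _ Ox)) cx).
have U0 : U !=set0.
  have : nbhs y [set x | c < g x].
    by apply: (continuous_near_gt (cg y Ky)); rewrite gy.
  by move/(KO y Ky).
have := rV_lebesgue_open_gt0 oU U0.
have [N [mN N0 hN]] := ess_sup_ge (rV_lebesgue R n) (fun x => if x \in O then (f x)%:E else -oo%E).
suff UN : U `<=` N.
  rewrite ltNge => /negP; apply; rewrite -N0.
  by apply: le_measure; rewrite ?inE//; exact: rV_open_measurable.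
move=> x [Ox cx]; apply: hN => /=; rewrite (mem_set Ox) fg//.
by move=> /le_trans/(_ Ec); rewrite lee_fin leNgt cx.
Qed.

End essential_supremum.

(** * The test function *)

Section polynomial_functions.
Context {R : realType} (n : nat).
Implicit Types (f g : 'rV[R]_n -> R) (i j : 'I_n) (x y : 'rV[R]_n).

(** An inductive form of polynomial functions: stability under [partial] then yields smoothness of
    every order, and the rules of calculus need no differentiability side conditions. *)
Inductive poly_fun : ('rV[R]_n -> R) -> Prop :=
| poly_fun_cst (c : R) : poly_fun (fun=> c)
| poly_fun_coord j : poly_fun (fun y => y ord0 j)
| poly_funD f g : poly_fun f -> poly_fun g -> poly_fun (fun y => f y + g y)
| poly_funM f g : poly_fun f -> poly_fun g -> poly_fun (fun y => f y * g y).

Lemma poly_fun_differentiable f y : poly_fun f -> differentiable f y.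
Proof.
elim => [c|j|{}f g _ df _ dg|{}f g _ df _ dg].
- exact: differentiable_cst.
- exact: differentiable_coord.
- exact: (differentiableD df dg).
- exact: (differentiableM df dg).
Qed.

Lemma poly_fun_continuous f : poly_fun f -> continuous f.
Proof.
by move=> pf y; apply: differentiable_continuous; exact: poly_fun_differentiable.
Qed.

Lemma poly_fun_derivable f y v : poly_fun f -> derivable f y v.
Proof. by move=> pf; apply: diff_derivable; exact: poly_fun_differentiable. Qed.

Lemma partial_cst i (c : R) : partial i (fun _ : 'rV[R]_n => c) = fun=> 0.
Proof. by apply/funext => y; exact: (derive_cst c y). Qed.

Lemma partial_coord i j :
  partial i (fun y : 'rV[R]_n => y ord0 j) = fun=> (j == i)%:R.
Proof.
apply/funext => y; rewrite /partial /derive.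
apply: lim_near_cst => //; near=> h.
rewrite /= !mxE eqxx /= addrK /GRing.scale /= mulrA mulVf ?mul1r//.
by near: h; exact: nbhs_dnbhs_neq.
Unshelve. all: by end_near. Qed.

Lemma partialD i f g : poly_fun f -> poly_fun g ->
  partial i (fun y => f y + g y) = fun y => partial i f y + partial i g y.
Proof.
move=> pf pg; apply/funext => y; rewrite /partial.
have df : derivable f y (delta_mx ord0 i) by exact: poly_fun_derivable.
have dg : derivable g y (delta_mx ord0 i) by exact: poly_fun_derivable.
exact: (@deriveD _ _ _ f g y (delta_mx ord0 i) df dg).
Qed.

Lemma partialM i f g : poly_fun f -> poly_fun g ->
  partial i (fun y => f y * g y) = fun y => f y * partial i g y + partial i f y * g y.
Proof.
move=> pf pg; apply/funext => y.
have df : derivable f y (delta_mx ord0 i) by exact: poly_fun_derivable.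
have dg : derivable g y (delta_mx ord0 i) by exact: poly_fun_derivable.
by have [_ E] := is_deriveM_dir (derivableP df) (derivableP dg).
Qed.

Lemma poly_fun_partial f i : poly_fun f -> poly_fun (partial i f).
Proof.
elim => [c|j|{}f g pf dpf pg dpg|{}f g pf dpf pg dpg].
- by rewrite partial_cst; exact: poly_fun_cst.
- by rewrite partial_coord; exact: poly_fun_cst.
- by rewrite partialD//; exact: poly_funD.
- by rewrite partialM//; apply: poly_funD; apply: poly_funM.
Qed.

Lemma poly_fun_partials f s : poly_fun f -> poly_fun (partials s f).
Proof. by move=> pf; elim: s => //= i s; exact: poly_fun_partial. Qed.

Lemma poly_funX f m : poly_fun f -> poly_fun (fun y => f y ^+ m).
Proof.
move=> pf; elim: m => [|m IH]; first exact: poly_fun_cst.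
by under eq_fun do rewrite exprS; exact: poly_funM.
Qed.

Lemma poly_fun_sum (I : Type) (r : seq I) (F : I -> 'rV[R]_n -> R) :
  (forall a : I, poly_fun (F a)) -> poly_fun (fun y => \sum_(a <- r) F a y).
Proof.
move=> pF; elim: r => [|i r IH].
  by under eq_fun do rewrite big_nil; exact: poly_fun_cst.
by under eq_fun do rewrite big_cons; exact: poly_funD.
Qed.

Lemma poly_fun_prod (I : Type) (r : seq I) (F : I -> 'rV[R]_n -> R) :
  (forall a : I, poly_fun (F a)) -> poly_fun (fun y => \prod_(a <- r) F a y).
Proof.
move=> pF; elim: r => [|i r IH].
  by under eq_fun do rewrite big_nil; exact: poly_fun_cst.
by under eq_fun do rewrite big_cons; exact: poly_funM.
Qed.

Lemma poly_fun_smooth f m D : poly_fun f -> continuously_differentiable m D f.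
Proof.
move=> pf s _; have ps := poly_fun_partials s pf; split.
  by move=> x _; exact: poly_fun_continuous.
by move=> _ i x _; exact: poly_fun_derivable.
Qed.

Lemma partialX i f m : poly_fun f ->
  partial i (fun y => f y ^+ m.+1) = fun y => m.+1%:R * f y ^+ m * partial i f y.
Proof.
move=> pf; elim: m => [|m IH].
  by apply/funext => y; rewrite mul1r expr0 mul1r; under [in LHS]eq_fun do rewrite expr1.
under eq_fun do rewrite exprS.
rewrite partialM//; last exact: poly_funX.
by apply/funext => y; rewrite IH -[in RHS]natr1 !exprS; ring.
Qed.

(** The displayed term arises when every derivative falls on the power and lowers its exponent. All
    other terms keep at least one more factor [f] and are collected in [A]. On the zero set of [f]
    only the displayed term can survive, and only for [size s = m]. *)
Lemma partials_powE f m s : poly_fun f -> (size s <= m)%N ->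
  exists2 A, poly_fun A & partials s (fun y => f y ^+ m) =
    fun y => (m ^_ size s)%:R * f y ^+ (m - size s) * \prod_(i <- s) partial i f y
      + f y ^+ (m - size s).+1 * A y.
Proof.
move=> pf; elim: s => [|i s IH] sm.
  exists (fun=> 0); first exact: poly_fun_cst.
  by apply/funext => y; rewrite /= big_nil ffactn0 subn0 mul1r mulr1 mulr0 addr0.
have [A pA E] := IH (ltnW sm); rewrite /= E.
have [d md] : exists d, (m - size s)%N = d.+1.
  by exists (m - (size s).+1)%N; rewrite subnS prednK// subn_gt0.
have -> : (m - (size s).+1)%N = d by rewrite subnS md.
set C : R := (m ^_ size s)%:R; set Pr := fun y => \prod_(j <- s) partial j f y.
have pPr : poly_fun Pr by apply: poly_fun_prod => j; exact: poly_fun_partial.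
have pf' := poly_fun_partial i pf.
(* These are the terms of the product rule that keep a factor [f ^+ d.+1], after it has been taken
   out; [d.+2] is the exponent that stood before the previous [A]. *)
exists (fun y => C * partial i Pr y + d.+2%:R * partial i f y * A y + f y * partial i A y).
  apply: poly_funD; last by apply: poly_funM => //; exact: poly_fun_partial.
  apply: poly_funD; first by apply: poly_funM; [exact: poly_fun_cst|exact: poly_fun_partial].
  by apply: poly_funM => //; apply: poly_funM => //; exact: poly_fun_cst.
rewrite md partialD; last 2 first.
- apply: poly_funM => //; apply: poly_funM; [exact: poly_fun_cst|exact: poly_funX].
- by apply: poly_funM => //; exact: poly_funX.
rewrite (@partialM _ (fun y => C * f y ^+ d.+1) Pr)//; last first.
  by apply: poly_funM; [exact: poly_fun_cst|exact: poly_funX].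
rewrite (@partialM _ (fun=> C) (fun y => f y ^+ d.+1)) ?partial_cst//; last 2 first.
- exact: poly_fun_cst.
- exact: poly_funX.
rewrite (@partialM _ (fun y => f y ^+ d.+2) A)//; last exact: poly_funX.
rewrite !partialX//; apply/funext => y; rewrite big_cons -/(Pr y).
have -> : (m ^_ (size s).+1)%:R = C * d.+1%:R :> R.
  by rewrite ffactnSr natrM md.
by rewrite !exprS; ring.
Qed.

Lemma poly_fun_scale f (c : R) x0 : poly_fun f ->
  poly_fun (fun y => f (c *: (y - x0))).
Proof.
elim => [b|j|{}f g _ pf _ pg|{}f g _ pf _ pg].
- exact: poly_fun_cst.
- under eq_fun do rewrite !mxE.
  apply: poly_funM; first exact: poly_fun_cst.
  apply: poly_funD; [exact: poly_fun_coord|exact: poly_fun_cst].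
- exact: poly_funD.
- exact: poly_funM.
Qed.

Lemma partial_scale f (c : R) x0 i : poly_fun f ->
  partial i (fun y => f (c *: (y - x0))) = fun y => c * partial i f (c *: (y - x0)).
Proof.
elim => [b|j|{}f g pf Ef pg Eg|{}f g pf Ef pg Eg].
- by rewrite !partial_cst; apply/funext => y; rewrite mulr0.
- under eq_fun do rewrite !mxE.
  have p1 := poly_fun_coord j; have p2 := poly_fun_cst (- x0 ord0 j).
  rewrite (@partialM _ (fun=> c) (fun y => y ord0 j - x0 ord0 j))//; last 2 first.
  + exact: poly_fun_cst.
  + exact: poly_funD.
  rewrite (@partialD _ (fun y => y ord0 j) (fun=> - x0 ord0 j))// !partial_cst partial_coord.
  by apply/funext => y; rewrite mul0r !addr0.
- have /= E := partialD i (poly_fun_scale c x0 pf) (poly_fun_scale c x0 pg).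
  by rewrite E Ef Eg partialD//; apply/funext => y; rewrite mulrDr.
- have /= E := partialM i (poly_fun_scale c x0 pf) (poly_fun_scale c x0 pg).
  by rewrite E Ef Eg partialM//; apply/funext => y; ring.
Qed.

Lemma partials_scale f (b c : R) x0 s : poly_fun f ->
  partials s (fun y => b * f (c *: (y - x0))) =
  fun y => b * (c ^+ size s * partials s f (c *: (y - x0))).
Proof.
move=> pf; elim: s => [|i s IH] /=.
  by apply/funext => y; rewrite mul1r.
have ps := poly_fun_partials s pf.
have pss := poly_fun_scale c x0 ps.
rewrite IH (@partialM _ (fun=> b) (fun y => c ^+ size s * partials s f (c *: (y - x0)))); last 2 first.
- exact: poly_fun_cst.
- by apply: poly_funM => //; exact: poly_fun_cst.
rewrite (@partialM _ (fun=> c ^+ size s) (fun y => partials s f (c *: (y - x0))))//; last first.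
  exact: poly_fun_cst.
by rewrite !partial_cst partial_scale//; apply/funext => y; rewrite exprS; ring.
Qed.

End polynomial_functions.

Lemma eq_continuous_at (T U : topologicalType) (f g : T -> U) (x : T) :
  f =1 g -> {for x, continuous f} -> {for x, continuous g}.
Proof. by move=> /funext ->. Qed.

Section euclidean_ball.
Context {R : realType} (n : nat).
Implicit Types (a b x y nu : 'rV[R]_n).

Definition dotp a b : R := \sum_i a ord0 i * b ord0 i.

(** Positive exactly in the open Euclidean ball about 0 whose sphere contains [a]. It is written
    with [dotp] because the norm of row vectors is the maximum norm. *)
Definition ball_fun a nu : R := dotp a a - dotp nu nu.

Lemma dotp_ge0 a : 0 <= dotp a a.
Proof. by apply: sumr_ge0 => i _; rewrite -expr2 sqr_ge0. Qed.

Lemma dotp_coord a i : a ord0 i ^+ 2 <= dotp a a.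
Proof.
rewrite /dotp (bigD1 i)//= -expr2 lerDl.
by apply: sumr_ge0 => j _; rewrite -expr2 sqr_ge0.
Qed.

Lemma dotp_eq0 a : dotp a a = 0 -> a = 0.
Proof.
move=> a0; apply/rowP => i; rewrite mxE; apply/eqP.
by rewrite -sqrf_eq0 eq_le sqr_ge0 andbT -a0 dotp_coord.
Qed.

Lemma norm_le_dotp a (M : R) : 0 <= M -> dotp a a <= M ^+ 2 -> `|a| <= M.
Proof.
move=> M0 aM; rewrite norm_rV_le//; apply/forallP => i.
by rewrite -(@ler_pXn2r _ 2) ?nnegrE// real_normK ?num_real// (le_trans (dotp_coord _ _)).
Qed.

Lemma dotpZ (c : R) a : dotp (c *: a) (c *: a) = c ^+ 2 * dotp a a.
Proof. by rewrite /dotp mulr_sumr; apply: eq_bigr => i _; rewrite !mxE; ring. Qed.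

Lemma dotpZr (c : R) a b : dotp a (c *: b) = c * dotp a b.
Proof. by rewrite /dotp mulr_sumr; apply: eq_bigr => i _; rewrite mxE; ring. Qed.

Lemma dotpC a b : dotp a b = dotp b a.
Proof. by apply: eq_bigr => i _; rewrite mulrC. Qed.

Lemma dotp_sub a b : dotp (a - b) (a - b) = dotp a a + dotp b b - 2 * dotp a b.
Proof.
rewrite /dotp mulr_sumr -big_split -sumrB /=; apply: eq_bigr => i _.
by rewrite !mxE; ring.
Qed.

Lemma poly_ball_fun a : poly_fun (ball_fun a).
Proof.
rewrite (_ : ball_fun a = fun nu => dotp a a + (-1) * \sum_i nu ord0 i * nu ord0 i).
  apply: poly_funD; first exact: poly_fun_cst.
  apply: poly_funM; first exact: poly_fun_cst.
  by apply: poly_fun_sum => i; apply: poly_funM; exact: poly_fun_coord.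
by apply/funext => nu; rewrite mulN1r.
Qed.

Lemma poly_fun_partial_sum (I : Type) (r : seq I) (F : I -> 'rV[R]_n -> R) i :
  (forall j : I, poly_fun (F j)) ->
  partial i (fun y => \sum_(j <- r) F j y) = fun y => \sum_(j <- r) partial i (F j) y.
Proof.
move=> pF; elim: r => [|j r IH].
  under eq_fun do rewrite big_nil.
  by rewrite partial_cst; apply/funext => y; rewrite big_nil.
under eq_fun do rewrite big_cons.
rewrite partialD//; last exact: poly_fun_sum.
by apply/funext => y; rewrite big_cons IH.
Qed.

Lemma partial_ball_fun a i nu : partial i (ball_fun a) nu = - 2 * nu ord0 i.
Proof.
pose F := fun (j : 'I_n) (nu : 'rV[R]_n) => nu ord0 j * nu ord0 j.
have pF j : poly_fun (F j) by apply: poly_funM; exact: poly_fun_coord.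
rewrite (_ : ball_fun a = fun nu => dotp a a + (-1) * \sum_j F j nu); last first.
  by apply/funext => y; rewrite mulN1r.
have pS := poly_fun_sum (index_enum 'I_n) pF.
rewrite partialD ?partial_cst; last 2 first.
- exact: poly_fun_cst.
- by apply: poly_funM => //; exact: poly_fun_cst.
rewrite (@partialM _ _ i (fun=> -1) (fun nu => \sum_j F j nu))//; last exact: poly_fun_cst.
rewrite partial_cst poly_fun_partial_sum// mul0r addr0 add0r.
have dF j : partial i (F j) nu = 2 * nu ord0 j * (j == i)%:R.
  rewrite /F (partialM _ (poly_fun_coord j) (poly_fun_coord j)) !partial_coord.
  by ring.
under eq_bigr do rewrite dF.
rewrite (bigD1 i)//= big1 ?addr0 => [|j /negbTE ->]; last by rewrite mulr0.
by rewrite eqxx mulr1; ring.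
Qed.

Lemma partials_bump a k s nu : (size s < k)%N -> ball_fun a nu = 0 ->
  partials s (fun y => ball_fun a y ^+ k) nu = 0.
Proof.
move=> sk a0; have [A _ ->] := partials_powE (poly_ball_fun a) (ltnW sk).
rewrite a0 [X in _ + X * _]expr0n mul0r addr0.
by rewrite expr0n subn_eq0 leqNgt sk mulr0 mul0r.
Qed.

Lemma partials_bump_top a k s nu : size s = k -> ball_fun a nu = 0 ->
  partials s (fun y => ball_fun a y ^+ k) nu =
  k`!%:R * (- 2) ^+ k * \prod_(i <- s) nu ord0 i.
Proof.
move=> sk a0; have [|A _ ->] := @partials_powE R n (ball_fun a) k s (poly_ball_fun a).
  by rewrite sk.
rewrite sk subnn a0 expr0 expr1 mul0r addr0 ffactnn mulr1 -mulrA; congr (_ * _).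
rewrite (eq_bigr (fun i => - 2 * nu ord0 i)); last by move=> i _; exact: partial_ball_fun.
by rewrite big_split /= big_const_seq count_predT sk iter_mulr_1.
Qed.

End euclidean_ball.

Section bump.
Context {R : realType} (n k : nat).
Variables (x0 a : 'rV[R]_n) (rho sigma : R).
Hypotheses (rho0 : 0 < rho) (sigma0 : sigma != 0) (a0 : 0 < dotp a a).
Hypothesis k0 : (0 < k)%N.
Implicit Types (y : 'rV[R]_n) (s : seq 'I_n).

Definition rescale y : 'rV[R]_n := rho^-1 *: (y - x0).

Definition open_ball := [set y | 0 < ball_fun a (rescale y)].
Definition closed_ball := [set y | 0 <= ball_fun a (rescale y)].
Definition bump_poly y : R := sigma * ball_fun a (rescale y) ^+ k.
Definition bump := bump_poly \_ open_ball.

Lemma rescale_continuous : continuous rescale.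
Proof.
move=> y; apply: (@cvgZ _ _ _ (nbhs y)); first exact: cvg_cst.
by apply: cvgB; [exact: cvg_id|exact: cvg_cst].
Qed.

Lemma ball_rescale_continuous : continuous (fun y => ball_fun a (rescale y)).
Proof.
move=> y; apply: continuous_comp; first exact: rescale_continuous.
exact: (poly_fun_continuous (poly_ball_fun a)).
Qed.

Lemma open_ball_open : open open_ball.
Proof.
rewrite openE => y; exact: (continuous_near_gt (@ball_rescale_continuous y)).
Qed.

Lemma closed_ball_closed : closed closed_ball.
Proof.
rewrite -[closed_ball]setCK; apply: open_closedC; rewrite openE => y /= /negP.
rewrite -ltNge => /(continuous_near_lt (@ball_rescale_continuous y)).
by apply: filterS => z; rewrite /closed_ball /= ltNge => /negP.
Qed.

Lemma open_ball_sub : open_ball `<=` closed_ball.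
Proof. by move=> y; exact: ltW. Qed.

Lemma rescaleK y : y = x0 + rho *: rescale y.
Proof. by rewrite scalerA mulfV ?gt_eqF// scale1r addrC subrK. Qed.

Lemma closed_ball_norm y M : 0 <= M -> dotp a a <= M ^+ 2 ->
  closed_ball y -> `|rescale y| <= M.
Proof.
move=> M0 aM yK; apply: norm_le_dotp => //; apply: le_trans aM.
by move: yK; rewrite /closed_ball /= subr_ge0.
Qed.

Lemma closed_ball_compact : compact closed_ball.
Proof.
apply: bounded_closed_compact; last exact: closed_ball_closed.
pose M := 1 + dotp a a.
have M0 : 0 <= M by rewrite addr_ge0 ?dotp_ge0.
have aM : dotp a a <= M ^+ 2.
  by have := dotp_ge0 a; rewrite /M => h; nra.
exists (`|x0| + rho * M); split=> [|r /ltW Mr y Ky]; first exact: num_real.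
apply: le_trans Mr; rewrite [y in `|y|]rescaleK (le_trans (ler_normD _ _))// lerD2l.
by rewrite normrZ gtr0_norm// ler_pM2l// closed_ball_norm.
Qed.

Lemma closed_ball_closure : closed_ball `<=` closure open_ball.
Proof.
move=> y yK B /nbhs_ballP[d /= d0 dB].
pose M := `|y - x0| + 1.
have M0 : 0 < M by rewrite ltr_wpDl.
(* [y] is moved towards the centre by the factor [1 - t]. This choice gives both [t < 1] and
   [t * M < d], so that the new point is inside the open ball and within [d] of [y]. *)
pose t := d / (M + d).
have Md0 : 0 < M + d by rewrite addr_gt0.
have t0 : 0 < t by rewrite divr_gt0.
have t1 : t < 1 by rewrite /t (ltr_pdivrMr _ _ Md0) mul1r ltrDr.
exists (y - t *: (y - x0)); split.
  rewrite /open_ball /= subr_gt0.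
  have -> : rescale (y - t *: (y - x0)) = (1 - t) *: rescale y.
    rewrite /rescale [RHS]scalerA [_ * rho^-1]mulrC -[RHS]scalerA; congr (_ *: _).
    by rewrite scalerBl scale1r addrAC.
  rewrite dotpZ; move: yK; rewrite /closed_ball /= subr_ge0 => h.
  have h0 := dotp_ge0 (rescale y).
  have : (1 - t) ^+ 2 * dotp (rescale y) (rescale y) <= (1 - t) ^+ 2 * dotp a a.
    by rewrite ler_wpM2l// sqr_ge0.
  move=> /le_lt_trans; apply.
  rewrite gtr_pMl// expr2; nra.
apply: dB; rewrite -ball_normE /= opprB addrC subrK normrZ gtr0_norm//.
apply: (@le_lt_trans _ _ (t * M)); first by rewrite ler_pM2l// lerDl.
by rewrite /t mulrAC (ltr_pdivrMr _ _ Md0) ltr_pM2l// ltrDl.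
Qed.

Lemma poly_bump : poly_fun bump_poly.
Proof.
apply: poly_funM; first exact: poly_fun_cst.
by apply: poly_funX; apply: poly_fun_scale; exact: poly_ball_fun.
Qed.

Lemma partials_bump_poly s y : partials s bump_poly y =
  sigma * (rho^-1 ^+ size s * partials s (fun nu => ball_fun a nu ^+ k) (rescale y)).
Proof.
exact: (congr1 (fun f => f y) (partials_scale sigma rho^-1 x0 s (poly_funX k (poly_ball_fun a)))).
Qed.

Lemma bump_neq0 : [set y | bump y != 0] = open_ball.
Proof.
apply/seteqP; split => y /=; rewrite /bump patchE.
  by case: ifPn => [/set_mem//|_]; rewrite eqxx.
by move=> yS; rewrite (mem_set yS) mulf_neq0// expf_neq0// gt_eqF.
Qed.

Lemma bump_continuous : continuous bump.
Proof.
(* The truncation is a power of the positive part (b + |b|) / 2; outside the ball this uses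
   [0 ^+ k = 0], hence [0 < k]. *)
have -> : bump = fun y => sigma * ((ball_fun a (rescale y) + `|ball_fun a (rescale y)|) / 2) ^+ k.
  apply/funext => y; rewrite /bump patchE; case: ifPn => [/set_mem yS|].
    by rewrite /bump_poly gtr0_norm// -mulr2n -(mulr_natr (ball_fun _ _)) mulfK.
  rewrite notin_setE /open_ball /= => /negP; rewrite -leNgt => yS.
  by rewrite ler0_norm// subrr mul0r expr0n gtn_eqF// mulr0.
move=> y; have c1 := @ball_rescale_continuous y.
have c2 : {for y, continuous (fun y => `|ball_fun a (rescale y)|)}.
  by apply: continuous_comp c1 _; exact: norm_continuous.
have c3 := continuousM (continuousD c1 c2) (@cst_continuous _ _ (2^-1 : R) y).
have c4 m : {for y, continuous (fun y => ((ball_fun a (rescale y) + `|ball_fun a (rescale y)|) / 2) ^+ m)}.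
  elim: m => [|m IH]; first exact: cst_continuous.
  apply: eq_continuous_at (continuousM c3 IH).
  by move=> z; rewrite exprS.
exact: (continuousM (@cst_continuous _ _ sigma y) (c4 k)).
Qed.

Lemma support_bump : support bump `<=` closed_ball.
Proof.
rewrite /support bump_neq0 closureE; apply: smallest_sub.
  exact: closed_ball_closed.
exact: open_ball_sub.
Qed.

Lemma bump_compactly_supported D : closed_ball `<=` D -> compactly_supported D bump.
Proof.
move=> KD; split; last exact: subset_trans support_bump KD.
apply: subclosed_compact closed_ball_compact support_bump.
exact: closed_closure.
Qed.

(** Supplies the geometric hypothesis of [integral_by_parts_cut]: by convexity a line meets the ball
    in an interval, whose ends lie on the sphere. *)
Lemma open_ball_line i (x : 'rV[R]_n) : exists l r : R,
  (forall t, open_ball (rV_upd i x t) <-> l < t < r) /\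
  (l < r -> ball_fun a (rescale (rV_upd i x l)) = 0 /\
            ball_fun a (rescale (rV_upd i x r)) = 0).
Proof.
(* When positive, [beta] is the square of half the length of the chord, in rescaled units. *)
pose beta := dotp a a - \sum_(j < n | j != i) (rho^-1 * (x ord0 j - x0 ord0 j)) ^+ 2.
have E t : ball_fun a (rescale (rV_upd i x t)) = beta - (rho^-1 * (t - x0 ord0 i)) ^+ 2.
  rewrite /ball_fun /beta.
  have -> : dotp (rescale (rV_upd i x t)) (rescale (rV_upd i x t)) =
      (rho^-1 * (t - x0 ord0 i)) ^+ 2 +
      \sum_(j < n | j != i) (rho^-1 * (x ord0 j - x0 ord0 j)) ^+ 2.
    rewrite /dotp (bigD1 i)//= !mxE eqxx -expr2; congr (_ + _).
    by apply: eq_bigr => j ji; rewrite !mxE (negbTE ji) expr2.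
  by ring.
have [b0|b0] := leP beta 0.
  (* The line misses the open ball, so any empty interval will do. *)
  exists 0, 0; split; last by rewrite ltxx.
  move=> t; split => [|/andP[t0 t1]]; last by have := lt_trans t0 t1; rewrite ltxx.
  rewrite /open_ball /= E => h.
  by have := sqr_ge0 (rho^-1 * (t - x0 ord0 i)); lra.
pose w := rho * Num.sqrt beta.
have sb : Num.sqrt beta ^+ 2 = beta by rewrite sqr_sqrtr// ltW.
exists (x0 ord0 i - w), (x0 ord0 i + w); split.
  move=> t; rewrite /open_ball /= E subr_gt0.
  have -> : (x0 ord0 i - w < t < x0 ord0 i + w) = (`|t - x0 ord0 i| < w).
    by rewrite ltr_distl.
  rewrite -sb -[X in X < _]real_normK ?num_real// ltr_pXn2r ?nnegrE ?sqrtr_ge0//.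
  by rewrite normrM gtr0_norm ?invr_gt0// mulrC ltr_pdivrMr// mulrC.
move=> _; have wE : (rho^-1 * w) ^+ 2 = beta by rewrite /w mulKf ?gt_eqF// sb.
rewrite !E; split.
  by rewrite (_ : _ - w - _ = - w) ?mulrN ?sqrrN ?wE ?subrr//; ring.
by rewrite (_ : _ + w - _ = w) ?wE ?subrr//; ring.
Qed.

(** In every integration by parts the function being differentiated has order below [k], so it
    vanishes on the sphere. Derivatives of order [k], which need not vanish there, occur only as the
    result. *)
Lemma bump_weak_partial D s t : open D -> closed_ball `<=` D -> (size s <= k)%N ->
  perm_eq s t -> weak_partial D s bump (partials t bump_poly \_ open_ball).
Proof.
move=> oD KD sk st.
have pb := poly_bump.
apply: (@weak_partial_family _ _ D k (fun s => partials s bump_poly \_ open_ball)) => //.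
- move=> r _; apply: loc_bounded_patch; first exact: open_ball_open.
  by apply: poly_fun_continuous; exact: poly_fun_partials.
- move=> r i rk; have pr := poly_fun_partials r pb.
  apply: integral_by_parts_cut => //.
  + exact: open_ball_open.
  + exact: subset_trans open_ball_sub KD.
  + exact: poly_fun_continuous.
  + by move=> x; exact: poly_fun_derivable.
  + by apply: poly_fun_continuous; exact: poly_fun_partial.
  move=> x; have [l [r' [H1 H2]]] := open_ball_line i x.
  exists l, r'; split => // /H2[Hl Hr].
  by rewrite !partials_bump_poly !partials_bump// !mulr0.
- move=> r r' rk rr' x _; rewrite !patchE; case: ifP => // _.
  apply: (@partials_perm _ _ setT k) => //; first exact: openT.
    exact: poly_fun_smooth.
  exact: in_setT.
Qed.

End bump.

(** * The semi-differential along the test function *)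

Section classical_jets.
Context {R : realType} (n k : nat).
Implicit Types (D : set 'rV[R]_n) (u f : 'rV[R]_n -> R).

Definition word_sort (s : seq 'I_n) := sort (fun i j : 'I_n => (i <= j)%N) s.

Lemma jet_ofE (F : seq 'I_n -> R) (s : k.-bseq 'I_n) : jet_of k F s = F (word_sort s).
Proof. by rewrite ffunE. Qed.

Lemma classical_jetE u y (s : k.-bseq 'I_n) :
  classical_jet k u y s = partials (word_sort s) u y.
Proof. exact: jet_ofE. Qed.

Lemma size_word_sort (s : k.-bseq 'I_n) : (size (word_sort s) <= k)%N.
Proof. by rewrite size_sort size_bseq. Qed.

Lemma perm_word_sort (s : k.-bseq 'I_n) : perm_eq s (word_sort s).
Proof. by rewrite perm_sym perm_sort. Qed.

Lemma classical_jet_continuous D u y : continuously_differentiable k D u -> D y ->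
  {for y, continuous (classical_jet k u)}.
Proof.
move=> cu Dy; apply: jet_continuous => s.
apply: (@eq_continuous_at _ _ (partials (word_sort s) u)).
  by move=> z; rewrite classical_jetE.
have [c _] := cu (word_sort s) (size_word_sort s); exact: c.
Qed.

Lemma classical_jet_differentiable D u y : open D ->
  continuously_differentiable k.+1 D u -> D y ->
  differentiable (classical_jet k u) y.
Proof.
move=> oD cu Dy; apply: jet_differentiable => s.
rewrite (_ : (fun q => _) = partials (word_sort s) u); last first.
  by apply/funext => z; rewrite classical_jetE.
have sk := size_word_sort s.
apply: (C1_differentiable oD Dy).
  by move=> z i Dz; have [_ d] := cu (word_sort s) (leqW sk); exact: d.
by move=> i; have [c _] := cu (i :: word_sort s) sk; exact: c.
Qed.

Lemma classical_jet_weak D u : open D -> continuously_differentiable k D u ->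
  forall s : k.-bseq 'I_n, weak_partial D s u (fun x => classical_jet k u x s).
Proof.
move=> oD cu s.
rewrite (_ : (fun x => _) = partials (word_sort s) u); last first.
  by apply/funext => z; rewrite classical_jetE.
apply: (@weak_partial_family _ _ D k (fun s => partials s u)) => //.
- move=> r rk; apply: continuous_loc_bounded => // x Dx; have [c _] := cu r rk.
  exact: c.
- move=> r i rk; apply: integral_by_parts_C1 => //.
  + by move=> x Dx; have [c _] := cu r (ltnW rk); exact: c.
  + by move=> x Dx; have [_ d] := cu r (ltnW rk); exact: d.
  + by move=> x Dx; have [c _] := cu (i :: r) rk; exact: c.
- by move=> r r' rk rr'; exact: (partials_perm oD cu rk rr').
- by rewrite size_bseq.
- exact: perm_word_sort.
Qed.

Lemma continuously_differentiableW m m' D u : (m <= m')%N ->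
  continuously_differentiable m' D u -> continuously_differentiable m D u.
Proof.
move=> mm' cu s sm; have [c d] := cu s (leq_trans sm mm'); split => // sm1.
by apply: d; exact: leq_trans sm1 mm'.
Qed.

Lemma diff_gradient f x h : differentiable f x -> 'd f x h = dotp (gradient f x) h.
Proof.
move=> df; rewrite [h in LHS]row_sum_delta linear_sum /=; apply: eq_bigr => i _.
by rewrite linearZ /= -deriveE// mxE mulrC.
Qed.

Lemma diff_estimate f x (eps : R) : differentiable f x -> 0 < eps ->
  exists2 d : R, 0 < d & forall h, `|h| < d ->
    `|f (x + h) - f x - dotp (gradient f x) h| <= eps * `|h|.
Proof.
move=> df eps0; have /diff_locallyP[_ /eqaddoP/(_ _ eps0)] := df.
move=> /nbhs_ballP[d /= d0 hd]; exists d => // h hd'.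
have := hd h; rewrite -ball_normE /= sub0r normrN => /(_ hd').
rewrite /= !fctE /= diff_gradient// [h + x]addrC.
by rewrite opprD addrA.
Qed.

(** A tensor power is already symmetric, so averaging over rearrangements leaves its entries
    unchanged. *)
Lemma jet_topE (b : 'rV[R]_n) (s : k.-bseq 'I_n) :
  jet_top (tensor_pow k b) s =
  if size s == k then \prod_(i <- s) b ord0 i else 0.
Proof.
rewrite ffunE; case: ifPn => sk; last first.
  rewrite big_pred0 ?mul0r// => t; apply/negbTE; apply: contra sk => /perm_size <-.
  by rewrite size_tuple.
have E (t : k.-tuple 'I_n) : perm_eq t s -> tensor_pow k b t = \prod_(i <- s) b ord0 i.
  by move=> ts; rewrite ffunE -(perm_big _ ts) /= big_tuple.
have -> : \sum_(t : k.-tuple 'I_n | perm_eq t s) tensor_pow k b t =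
    \sum_(t : k.-tuple 'I_n | perm_eq t s) \prod_(i <- s) b ord0 i by exact: eq_bigr.
rewrite sumr_const -[#|_|]/(#|[pred t : k.-tuple 'I_n | perm_eq t s]|).
rewrite -[X in X / _ = _]mulr_natr mulfK// pnatr_eq0 -lt0n.
by apply/card_gt0P; exists (Tuple sk); rewrite inE /=.
Qed.

End classical_jets.

Section jet_lines.
Context {R : realType} (n k : nat).
Variables (Omega : set 'rV[R]_n) (H : 'rV[R]_n * jet R n k -> R).
Hypothesis hH : C1_on_jets Omega H.

Lemma jet_lineE (X Z : jet R n k) (t : R) s : (X + t *: Z) s = X s + t * Z s.
Proof. by rewrite !ffunE. Qed.

Lemma is_derive_jet_line y (X Z : jet R n k) (t : R) : Omega y ->
  is_derive t (1 : R) (fun t : R => H (y, X + t *: Z)) ('d H (y, X + t *: Z) (0, Z)).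
Proof.
move=> Oy.
have E r : (y, X) + r *: ((0, Z) : 'rV[R]_n * jet R n k) = (y, X + r *: Z).
  by congr pair; rewrite /= scaler0 addr0.
have [dH _] := hH (p := (y, X + t *: Z)) Oy.
have := @is_derive_line _ _ H (y, X) (0, Z) t.
rewrite E deriveE// => /(_ (diff_derivable dH)).
by rewrite (_ : (fun _ => _) = (fun t : R => H (y, X + t *: Z))) //; apply/funext => r; rewrite E.
Qed.

End jet_lines.

Section variation.
Context {R : realType} (n k : nat).
Variables (Omega : set 'rV[R]_n) (H : 'rV[R]_n * jet R n k -> R) (u : 'rV[R]_n -> R).
Variables (x0 a : 'rV[R]_n) (rho sigma : R).
Hypotheses (oO : open Omega) (hH : C1_on_jets Omega H).
Hypothesis hu : continuously_differentiable k Omega u.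
Hypotheses (rho0 : 0 < rho) (sigma0 : sigma != 0) (a0 : 0 < dotp a a).
Hypothesis k0 : (0 < k)%N.

Local Notation S := (open_ball x0 a rho).
Local Notation K := (closed_ball x0 a rho).
Local Notation phi := (bump k x0 a rho sigma).
Local Notation J := (classical_jet k u).
Local Notation Jphi := (classical_jet k (bump_poly k x0 a rho sigma)).

Hypothesis KO : K `<=` Omega.

Let Vphi y : jet R n k := if y \in S then Jphi y else 0.

Let smooth_phi : continuously_differentiable k setT (bump_poly k x0 a rho sigma).
Proof. by apply: poly_fun_smooth; exact: poly_bump. Qed.

Let VphiE (s : k.-bseq 'I_n) :
  (fun y => Vphi y s) = partials (word_sort s) (bump_poly k x0 a rho sigma) \_ S.
Proof.
apply/funext => y; rewrite /Vphi patchE; case: ifPn => _; last by rewrite ffunE.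
by rewrite classical_jetE.
Qed.

Let Vphi_weak : weak_jet Omega phi Vphi.
Proof.
move=> s; rewrite VphiE; apply: bump_weak_partial => //.
- by rewrite size_bseq.
- exact: perm_word_sort.
Qed.

Lemma bump_sobolev : sobolev_infty_c k Omega phi.
Proof.
split; [exact: bump_continuous|exact: bump_compactly_supported|].
exists Vphi; first exact: Vphi_weak.
have bd (s : k.-bseq 'I_n) : exists M : R, forall y, `|Vphi y s| <= M.
  have cP : continuous (partials (word_sort s) (bump_poly k x0 a rho sigma)).
    by apply: poly_fun_continuous; apply: poly_fun_partials; exact: poly_bump.
  have [_ b] := continuous_loc_bounded openT (fun y _ => cP y).
  have cK : compact K by exact: closed_ball_compact.
  have [M hM] := b K cK (@subsetT _ _).
  exists `|M| => y; rewrite (congr1 (fun f => f y) (VphiE s)) patchE.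
  case: ifPn => [/set_mem yS|_]; last by rewrite normr0.
  by rewrite (le_trans (hM y (open_ball_sub yS)))// ler_norm.
have [M hM] := choice bd.
exists (\sum_s `|M s|); apply: nearW => y _ s.
rewrite (le_trans (hM s y))// (le_trans (ler_norm _))// (bigD1 s)//= lerDl.
by apply: sumr_ge0.
Qed.

Lemma continuous_jet_line y (t : R) : Omega y ->
  {for y, continuous (fun z => H (z, J z + t *: Jphi z))}.
Proof.
move=> Oy; have [dH _] := hH (p := (y, J y + t *: Jphi y)) Oy.
apply: (@continuous_comp _ _ _ (fun z => (z, J z + t *: Jphi z)) H); last first.
  exact: differentiable_continuous.
have c1 := classical_jet_continuous hu Oy.
have c2 : {for y, continuous Jphi} by exact: classical_jet_continuous smooth_phi _.
have c3 : {for y, continuous (fun z => J z + t *: Jphi z)}.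
  apply: (@continuousD _ _ _ J (fun z => t *: Jphi z)) => //.
  by apply: continuousZ => //; exact: cst_continuous.
exact: (cvg_pair cvg_id c3).
Qed.

(* Inside the ball the perturbed jet extends smoothly to the closed ball, so the
   essential supremum is a maximum over the closed ball and Danskin's theorem
   applies. *)
Lemma bump_semidifferential : exists l y,
  [/\ K y, forall z, K z -> H (z, J z) <= H (y, J y),
      l = 'd H (y, J y) (0, Jphi y) &
      total_semidifferential H Omega u phi l%:E].
Proof.
pose g (t : R) y := H (y, J y + t *: Jphi y).
pose dg (t : R) y := 'd H (y, J y + t *: Jphi y) (0, Jphi y).
have g0 y : g 0 y = H (y, J y) by rewrite /g scale0r addr0.
have cK : compact K by exact: closed_ball_compact.
have clK : closed K by exact: closed_ball_closed.
have Sx0 : S x0.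
  rewrite /open_ball /= /rescale subrr scaler0 /ball_fun.
  by rewrite [X in _ - X]big1 ?subr0// => i _; rewrite mxE mul0r.
have K0 : K !=set0 by exists x0; exact: open_ball_sub.
have maxg t : exists y, K y /\ forall z, K z -> g t z <= g t y.
  have cg : {within K, continuous (g t)}.
    by apply: continuous_in_subspaceT => y /set_mem Ky; apply: continuous_jet_line; exact: KO.
  have [y /set_mem Ky hy] := compact_EVT_max K0 cK cg.
  by exists y; split => // z Kz; apply: hy; exact/mem_set.
have [ymax hymax] := choice maxg.
pose m t := g t (ymax t).
have [|||||l [[y [Ky gy] ly] cvl]] := @danskin R _ K g dg m cK clK.
- by move=> t y Ky; apply: (is_derive_jet_line hH); exact: KO.
- by move=> y Ky; apply: continuous_jet_line; exact: KO.
- move=> y Ky; have Oy := KO Ky.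
  have csnd : {for (0 : R, y), continuous (@snd R 'rV[R]_n)} by exact: cvg_snd.
  have cfst : {for (0 : R, y), continuous (@fst R 'rV[R]_n)} by exact: cvg_fst.
  have c1 : {for (0 : R, y), continuous (fun p : R * 'rV[R]_n => J p.2)}.
    by apply: continuous_comp csnd _; exact: classical_jet_continuous hu Oy.
  have c2 : {for (0 : R, y), continuous (fun p : R * 'rV[R]_n => Jphi p.2)}.
    by apply: continuous_comp csnd _; exact: classical_jet_continuous smooth_phi _.
  apply: (@diff_jet_continuous _ _ _ _ _ hH _
    (fun p : R * 'rV[R]_n => (p.2, J p.2 + p.1 *: Jphi p.2)) (fun p => Jphi p.2)).
  + by apply: csnd; exact: open_nbhs_nbhs.
  + have c3 := continuousZ cfst c2.
    exact: (cvg_pair csnd (continuousD c1 c3)).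
  + move=> s.
    apply: (@eq_continuous_at _ _ (partials (word_sort s) (bump_poly k x0 a rho sigma) \o snd)).
      by move=> p; rewrite /= classical_jetE.
    apply: continuous_comp csnd _; apply: poly_fun_continuous; apply: poly_fun_partials.
    exact: poly_bump.
- by move=> t y Ky; have [_] := hymax t; apply.
- by move=> t; exists (ymax t) => //; have [] := hymax t.
exists l, y; split.
- exact: Ky.
- by move=> z Kz; rewrite -!g0 gy; have [_] := hymax 0; exact.
- have J0 : J y + 0 *: Jphi y = J y by rewrite scale0r addr0.
  apply: (etrans ly); exact: (congr1 (fun X => 'd H (y, X) (0, Jphi y)) J0).
split.
  move=> phi0; have : phi x0 != 0.
    suff : [set y | phi y != 0] x0 by [].
    by rewrite bump_neq0.
  by rewrite phi0 eqxx.
move=> _; exists (fun t => (m t)%:E); split; last first.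
  apply: cvg_EFin; first by apply: nearW.
  by move: cvl; apply: cvg_trans; apply: near_eq_cvg; apply: nearW.
move=> t t0; exists (fun y => J y + t *: Vphi y).
  move=> s.
  rewrite [X in weak_partial _ _ _ X](_ : _ = fun x => J x s + t * Vphi x s); last first.
    by apply/funext => x; exact: (jet_lineE (J x) (Vphi x) t s).
  have bdJ (r : seq 'I_n) : (size r <= k)%N -> loc_bounded Omega (partials r u).
    by move=> rk; apply: continuous_loc_bounded => // x Ox; have [c _] := hu rk; exact: c.
  apply: weak_partial_lin => //.
  - exact: (bdJ [::]).
  - by apply: continuous_loc_bounded => // x _; exact: bump_continuous.
  - rewrite (_ : (fun x => _) = partials (word_sort s) u); last first.
      by apply/funext => x; rewrite classical_jetE.
    by apply: bdJ; exact: size_word_sort.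
  - rewrite VphiE; apply: loc_bounded_patch; first exact: open_ball_open.
    by apply: poly_fun_continuous; apply: poly_fun_partials; exact: poly_bump.
  - exact: classical_jet_weak.
rewrite bump_neq0//; apply/esym.
apply: (@ess_sup_on_max _ _ S K _ (g t)).
- exact: open_ball_open.
- exact: open_ball_sub.
- exact: closed_ball_closure.
- by move=> z zS; rewrite /g /Vphi mem_set.
- by move=> z Kz; apply: continuous_jet_line; exact: KO.
- by move=> z Kz; have [_] := hymax t; apply.
- by exists (ymax t) => //; have [] := hymax t.
Qed.

End variation.

(** * Rescaling and the limit rho -> 0 *)

Section scaled_direction.
Context {R : realType} (n k : nat).
Variables (Omega : set 'rV[R]_n) (H : 'rV[R]_n * jet R n k -> R) (u : 'rV[R]_n -> R).
Variables (x0 a : 'rV[R]_n) (sigma : R).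
Hypotheses (oO : open Omega) (hH : C1_on_jets Omega H).
Hypothesis hu : continuously_differentiable k Omega u.
Hypothesis Ox0 : Omega x0.

Local Notation J := (classical_jet k u).

(* rho^k times the k-jet of the test function, as a function of rho and of the
   rescaled point nu; unlike the jet itself it extends continuously to rho = 0. *)
Definition scaled_jet (r : R) (nu : 'rV[R]_n) : jet R n k :=
  jet_of k (fun s => sigma * (r ^+ (k - size s) *
    partials s (fun z => ball_fun a z ^+ k) nu)).

Lemma scaled_jet_bump (rho : R) y : 0 < rho ->
  rho ^+ k *: classical_jet k (bump_poly k x0 a rho sigma) y =
  scaled_jet rho (rescale x0 rho y).
Proof.
move=> rho0; apply/val_inj/ffunP => s; rewrite [LHS]ffunE.
rewrite [X in _ *: X]classical_jetE [RHS]jet_ofE partials_bump_poly.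
have sk := size_word_sort s.
have E : rho ^+ k = rho ^+ (k - size (word_sort s)) * rho ^+ size (word_sort s).
  by rewrite -exprD subnK.
rewrite [rho ^+ k]E exprVn /GRing.scale /=.
have r0 : rho ^+ size (word_sort s) != 0 by rewrite expf_neq0// gt_eqF.
by field.
Qed.

(** At 0 the factor [r ^+ (k - size s)] removes every order below [k], and [0 ^+ 0 = 1] keeps order
    [k], where [a] is on the sphere and [partials_bump_top] applies. *)
Lemma scaled_jet_top : scaled_jet 0 a =
  (sigma * (k`!%:R * (- 2) ^+ k)) *: jet_top (tensor_pow k a).
Proof.
apply/val_inj/ffunP => s; rewrite [RHS]ffunE [X in _ *: X]jet_topE [LHS]jet_ofE.
have aa : ball_fun a a = 0 by rewrite /ball_fun subrr.
have sk := size_word_sort s.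
have sz : size (word_sort s) = size s by rewrite size_sort.
rewrite sz in sk *.
case: eqVneq => [sE|sE].
  rewrite partials_bump_top ?sz// sE subnn expr0 mul1r.
  by rewrite (perm_big s) ?perm_sort// /GRing.scale /=; ring.
by rewrite expr0n subn_eq0 leqNgt ltn_neqAle sE sk /= mul0r mulr0 scaler0.
Qed.

(** The base point and the rescaled point are independent variables, so that y -> x0 and nu -> a can
    be controlled separately. *)
Lemma scaled_direction_continuous :
  {for ((0, x0), a) : R * 'rV[R]_n * 'rV[R]_n,
   continuous (fun p : R * 'rV[R]_n * 'rV[R]_n =>
     'd H (p.1.2, J p.1.2) (0, scaled_jet p.1.1 p.2))}.
Proof.
set p0 := (_, a).
have c1 : {for p0, continuous (fun p : R * 'rV[R]_n * 'rV[R]_n => p.1)} by exact: cvg_fst.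
have c2 : {for p0, continuous (fun p : R * 'rV[R]_n * 'rV[R]_n => p.2)} by exact: cvg_snd.
have c11 : {for p0, continuous (fun p : R * 'rV[R]_n * 'rV[R]_n => p.1.1)}.
  by apply: (continuous_comp c1); exact: cvg_fst.
have c12 : {for p0, continuous (fun p : R * 'rV[R]_n * 'rV[R]_n => p.1.2)}.
  by apply: (continuous_comp c1); exact: cvg_snd.
apply: (@diff_jet_continuous _ _ _ _ _ hH _
  (fun p : R * 'rV[R]_n * 'rV[R]_n => (p.1.2, J p.1.2))
  (fun p => scaled_jet p.1.1 p.2)).
- by apply: c12; exact: open_nbhs_nbhs.
- have cJ : {for p0, continuous (fun p : R * 'rV[R]_n * 'rV[R]_n => J p.1.2)}.
    exact: (@continuous_comp _ _ _ (fun p : R * 'rV[R]_n * 'rV[R]_n => p.1.2) J p0 c12 (classical_jet_continuous hu Ox0)).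
  exact: (cvg_pair c12 cJ).
move=> s; pose F (nu : 'rV[R]_n) := partials (word_sort s) (fun z => ball_fun a z ^+ k) nu.
pose m := (k - size (word_sort s))%N.
apply: (@eq_continuous_at _ _ (fun p : R * 'rV[R]_n * 'rV[R]_n => sigma * (p.1.1 ^+ m * F p.2))).
  by move=> p; rewrite jet_ofE.
have cF : {for p0, continuous (fun p : R * 'rV[R]_n * 'rV[R]_n => F p.2)}.
  apply: (@continuous_comp _ _ _ (fun p : R * 'rV[R]_n * 'rV[R]_n => p.2) F p0 c2).
  apply: poly_fun_continuous.
  by apply: poly_fun_partials; apply: poly_funX; exact: poly_ball_fun.
have cX : {for p0, continuous (fun p : R * 'rV[R]_n * 'rV[R]_n => p.1.1 ^+ m)}.
  apply: (@continuous_comp _ _ _ (fun p : R * 'rV[R]_n * 'rV[R]_n => p.1.1) (fun r => r ^+ m) p0 c11).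
  exact: exprn_continuous.
exact: (continuousM (@cst_continuous _ _ sigma p0) (continuousM cX cF)).
Qed.

Lemma diff_scaled_direction0 :
  'd H (x0, J x0) (0, scaled_jet 0 a) =
  sigma * (k`!%:R * (- 2) ^+ k) * tensor_dot (grad_top H x0 (J x0)) (tensor_pow k a).
Proof.
have [dH _] := hH (p := (x0, J x0)) Ox0.
rewrite grad_topP// deriveE// scaled_jet_top.
set c := sigma * _.
rewrite -[RHS]/(c *: _) -linearZ; congr ('d H _ _).
by congr pair; rewrite /= scaler0.
Qed.

End scaled_direction.

(** * Choice of the constants and the contradiction *)

Theorem theorem40 (R : realType) (n k : nat) (hn : (2 <= n)%N) (hk : (1 <= k)%N)
    (Omega : set 'rV[R]_n) (hOmega : open Omega)
    (H : 'rV[R]_n * jet R n k -> R) (hH : C1_on_jets Omega H)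
    (u : 'rV[R]_n -> R) (hu : continuously_differentiable k.+1 Omega u)
    (hE : forall phi : 'rV[R]_n -> R, sobolev_infty_c k Omega phi ->
      forall l : \bar R, total_semidifferential H Omega u phi l -> (0 <= l)%E) :
  forall x : 'rV[R]_n, Omega x ->
    tensor_dot (grad_top H x (classical_jet k u x))
      (tensor_pow k (gradient (fun y => H (y, classical_jet k u y)) x)) = 0.
Proof.
move=> x0 Ox0; pose J := classical_jet k u.
pose f y := H (y, J y).
rewrite -/J -/f; pose a := gradient f x0; rewrite -/a.
set D0 := tensor_dot _ _; apply/eqP; apply: contraT => D0n0.
have hu' : continuously_differentiable k Omega u by apply: continuously_differentiableW hu.
(* If [a] were 0, every entry of its [k]-th tensor power would be 0, as [k >= 1], and so would
   [D0]. *)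
have aa0 : 0 < dotp a a.
  rewrite lt_neqAle dotp_ge0 andbT eq_sym; apply: contra D0n0 => /eqP/dotp_eq0 a0.
  apply/eqP; rewrite /D0 /tensor_dot big1// => s _; rewrite [X in _ * X]ffunE.
  by rewrite (bigD1 (Ordinal hk))//= a0 mxE mul0r mulr0.
pose c : R := k`!%:R * (- 2) ^+ k.
have c0 : c != 0.
  by rewrite mulf_neq0 ?pnatr_eq0 -?lt0n ?fact_gt0// expf_neq0// oppr_eq0 pnatr_eq0.
(* This turns the limit [sigma * c * D0] into minus a non-zero square. *)
pose sigma := - (c * D0).
have sigma0 : sigma != 0 by rewrite oppr_eq0 mulf_neq0.
pose Th (p : R * 'rV[R]_n * 'rV[R]_n) :=
  'd H (p.1.2, J p.1.2) (0, scaled_jet k a sigma p.1.1 p.2).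
have Th0 : Th ((0, x0), a) < 0.
  have -> : Th ((0, x0), a) = sigma * c * D0 by exact: diff_scaled_direction0 hH Ox0.
  have -> : sigma * c * D0 = - (c * D0) ^+ 2 by rewrite /sigma; ring.
  by rewrite oppr_lt0 exprn_even_gt0// mulf_neq0.
have cTh : {for ((0, x0), a), continuous Th}.
  exact: scaled_direction_continuous hOmega hH hu' Ox0.
have /nbhs_ballP[e /= e0 he] := continuous_near_lt cTh Th0.
have ThN r y nu : `|r| < e -> `|y - x0| < e -> `|nu - a| < e -> Th ((r, y), nu) < 0.
  move=> re ye nue; apply: (he ((r, y), nu)); split => /=.
    split => /=; first by rewrite -ball_normE /= sub0r normrN.
    by rewrite -ball_normE /= distrC.
  by rewrite -ball_normE /= distrC.
have df : differentiable f x0.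
  apply: (@differentiable_comp _ _ _ _ (fun y => (y, J y)) H).
    apply: differentiable_pair => //.
    exact: classical_jet_differentiable hOmega hu Ox0.
  by have [] := hH (x0, J x0) Ox0.
(* A positive bound for |a|, and so for the rescaled ball, obtained without a square root. *)
pose M := 1 + dotp a a.
have M0 : 0 < M by rewrite addr_gt0.
have aM : dotp a a <= M ^+ 2 by rewrite /M; nra.
(* Chosen so that [4 * (eps * M)], the final bound for the squared distance from [nu] to [a], equals
   [e ^+ 2 / 2]. *)
pose eps := e ^+ 2 / (8 * M).
have eps0 : 0 < eps by rewrite divr_gt0 ?exprn_gt0// mulr_gt0.
have [d1 d10 hd1] := diff_estimate df eps0.
have /nbhs_ballP[d2 /= d20 hd2] : nbhs x0 Omega by exact: open_nbhs_nbhs.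
pose d := Num.min e (Num.min d1 d2).
have d0 : 0 < d by rewrite !lt_min e0 d10 d20.
(* Makes both [rho] and [rho * M], a bound for the distance of points of the ball from [x0], smaller
   than [d]. *)
pose rho : R := d / (2 * (M + 1)).
have rho0 : 0 < rho by rewrite divr_gt0// mulr_gt0// addr_gt0.
have rhoM : rho * (2 * (M + 1)) = d by rewrite /rho divfK// gt_eqF// mulr_gt0// addr_gt0.
have rhod : rho < d by nra.
have rhoMd : rho * M < d by nra.
have [de dd1 dd2] : [/\ d <= e, d <= d1 & d <= d2].
  by rewrite /d !ge_min !lexx !orbT.
have Knorm y : closed_ball x0 a rho y -> `|rescale x0 rho y| <= M.
  by apply: closed_ball_norm => //; exact: ltW.
have Kdist y : closed_ball x0 a rho y -> `|y - x0| < d.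
  move=> Ky; rewrite {1}(rescaleK x0 rho0 y) addrC addKr normrZ gtr0_norm//.
  by apply: le_lt_trans rhoMd; rewrite ler_pM2l// Knorm.
have KO : closed_ball x0 a rho `<=` Omega.
  move=> y /Kdist yd; apply: hd2; rewrite -ball_normE /= distrC.
  exact: lt_le_trans dd2.
have [l [y [Ky ymax lE tsd]]] :=
  bump_semidifferential hOmega hH hu' rho0 sigma0 aa0 hk KO.
have sob : sobolev_infty_c k Omega (bump k x0 a rho sigma) by exact: bump_sobolev.
have := hE _ sob _ tsd.
rewrite lee_fin => l0.
pose nu := rescale x0 rho y.
(* The maximum at [y] is compared with the value at [x0 + rho *: a], a point of the sphere.
   Expanding [f] to first order at both points and dividing by [rho] gives a . (a - nu) <= 2 eps M.
   As nu . nu <= a . a, the squared Euclidean distance is at most twice the left side. *)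
have nua : `|nu - a| < e.
  have Ka : closed_ball x0 a rho (x0 + rho *: a).
    rewrite /closed_ball /= /rescale addrC addKr scalerA mulVf ?gt_eqF// scale1r.
    by rewrite /ball_fun subrr.
  have e1 : `|f (x0 + rho *: nu) - f x0 - dotp a (rho *: nu)| <= eps * `|rho *: nu|.
    by apply: hd1; rewrite normrZ gtr0_norm//; apply: le_lt_trans (lt_le_trans rhoMd dd1);
      rewrite ler_pM2l// Knorm.
  have aN : `|a| <= M by apply: norm_le_dotp => //; exact: ltW.
  have e2 : `|f (x0 + rho *: a) - f x0 - dotp a (rho *: a)| <= eps * `|rho *: a|.
    by apply: hd1; rewrite normrZ gtr0_norm//; apply: le_lt_trans (lt_le_trans rhoMd dd1);
      rewrite ler_pM2l.
  have fy := ymax _ Ka; rewrite -/(f _) -/(f _) in fy.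
  rewrite (rescaleK x0 rho0 y) -/nu in fy.
  rewrite dotpZr normrZ (gtr0_norm rho0) in e1; rewrite dotpZr normrZ (gtr0_norm rho0) in e2.
  have nuM := Knorm _ Ky; rewrite -/nu in nuM.
  have nn : dotp nu nu <= dotp a a by move: Ky; rewrite /closed_ball /= subr_ge0.
  have key : dotp a a - dotp a nu <= 2 * (eps * M).
    rewrite -(ler_pM2l rho0).
    have b1 : eps * (rho * `|nu|) <= eps * (rho * M) by rewrite !ler_pM2l.
    have b2 : eps * (rho * `|a|) <= eps * (rho * M) by rewrite !ler_pM2l.
    move: e1 e2; rewrite !ler_norml => /andP[? ?] /andP[? ?].
    by lra.
  have epsM : 4 * (eps * M) = e ^+ 2 / 2.
    by rewrite /eps; field; rewrite gt_eqF.
  have sub : dotp (nu - a) (nu - a) <= e ^+ 2 / 2.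
    by rewrite dotp_sub (dotpC nu a); lra.
  (* [norm_le_dotp] gives a weak inequality; the factor below 1 makes it strict. *)
  have : `|nu - a| <= e * Num.sqrt (2^-1).
    apply: norm_le_dotp; first by rewrite mulr_ge0 ?sqrtr_ge0// ltW.
    by rewrite exprMn sqr_sqrtr.
  move=> /le_lt_trans; apply; rewrite gtr_pMr//.
  by rewrite -[X in _ < X]sqrtr1 ltr_sqrt//; lra.
have neg : Th ((rho, y), nu) < 0.
  apply: ThN => //; last exact: lt_le_trans (Kdist _ Ky) de.
  by rewrite gtr0_norm// (lt_le_trans rhod).
(* Since [rho ^+ k] is positive, the semi-differential [l] has the sign of [Th], which contradicts
   [0 <= l]. *)
have E : Th ((rho, y), nu) = rho ^+ k * l.
  rewrite /Th /= -scaled_jet_bump// lE -[RHS]/(_ *: _) -linearZ; congr ('d H _ _).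
  by congr pair; rewrite /= scaler0.
by move: neg; rewrite E pmulr_rlt0 ?exprn_gt0// ltNge l0.
Qed.
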